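(* Assume $q\equiv 1\pmod 4$. Let $\mathrm{PGSp}^{\pm}(W)=\widetilde{\mathrm{GSp}}(W)/\nu(\widetilde{F^{\times 2}})$, which contains $\mathrm{Sp}(W)$ (embedded by $g\mapsto$ class of $[g,1]$) with quotient $F^{\times}/F^{\times 2}$, and let $\rho_\psi=\mathrm{Ind}_{\mathrm{Sp}(W)}^{\mathrm{PGSp}^{\pm}(W)}\pi_\psi$. Then the restriction of $\rho_\psi$ to $\mathrm{Sp}(W)$ consists of the two different Weil representations of $\mathrm{Sp}(W)$, i.e. it is isomorphic to $\pi_\psi\oplus\pi_{\psi^a}$ with $a\in F^\times\setminus F^{\times 2}$. Hence, up to isomorphism, this restriction is independent of the choice of the non-trivial character $\psi$.
   Context: $F=\mathbb F_q$ is a finite field of odd cardinality $q$; $(W,\langle,\rangle)$ is a symplectic $F$-space of dimension $2m$; groups act on $W$ on the right. $\mathrm{GSp}(W)$ is the group of symplectic similitudes, $\lambda:g\mapsto\lambda_g\in F^\times$ the similitude factor. The Heisenberg group $\mathrm{Ha}(W)=W\oplus F$ has law $(w,t)(w',t')=(w+w',t+t'+\tfrac12\langle w,w'\rangle)$. For a non-trivial character $\psi$ of $F$, put $\psi^a(t)=\psi(at)$. $\pi_\psi$ is the Weil representation of $\mathrm{Sp}(W)\ltimes\mathrm{Ha}(W)$ (extending the Heisenberg representation of central character $\psi$), restricted here to $\mathrm{Sp}(W)$. With $W=X\oplus X^*$ a complete polarization with symplectic basis $e_i\in X,e_i^*\in X^*$, it is realized on $\mathbb C[X]$ (functions on $X$)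 by $\pi_\psi\begin{pmatrix}1&b\\0&1\end{pmatrix}f(y)=\psi(\tfrac12\langle y,yb\rangle)f(y)$, $\pi_\psi\begin{pmatrix}a&0\\0&a^{*-1}\end{pmatrix}f(y)=\chi_q^+(\det a)f(ya)$, $\pi_\psi(\omega)f(y)=\gamma(\psi)^{-m}\sum_{x\in X}f(x)\psi(\langle x,y\omega\rangle)$, where $b\in\mathrm{Hom}(X,X^* )$ is symmetric, $a\in\mathrm{Aut}(X)$ with adjoint $a^*\in\mathrm{Aut}(X^* )$, $e_i\omega=-e_i^*$, $e_i^*\omega=e_i$, $\gamma(\psi)=\sum_{x\in F}\psi(x^2/2)$ and $\chi_q^+$ is the Legendre symbol of $F$. Construction of $\widetilde{\mathrm{GSp}}(W)$: fix a map $\sqrt{\ }:F^{\times2}\to F^\times$ with $(\sqrt a)^2=a$, $\sqrt1=1$, and let $c_{\sqrt{\ }}(a,b)\in\{\pm1\}$ be the 2-cocycle with $\sqrt a\sqrt b=c_{\sqrt{\ }}(a,b)\sqrt{ab}$; $\widetilde{F^{\times2}}$ is the corresponding central extension of $F^{\times 2}$ by $\{\pm1\}$, with elements $[a,\epsilon]$ and product $[a,\epsilon][b,\epsilon']=[ab,c_{\sqrt{\ }}(a,b)\epsilon\epsilon']$. Write $q-1=2^nl$ with $l$ odd, let $F_{2^n}\subset F^\times$ be the subgroup of order $2^n$, choose $\xi\in F_{2^n}$ a non-square, and let $\kappa:F^\times/F^{\times2}\to F^\times$ be the section $\kappa(\dot1)=1,\kappa(\dot\xi)=\xi$. Let $c'(\dot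 t_1,\dot t_2)=\kappa(\dot t_1)\kappa(\dot t_2)\kappa(\dot t_1\dot t_2)^{-1}\in F^{\times2}$. For $t_i=a_i^2\kappa(\dot t_i)\in F^\times$ put $c'''(t_1,t_2)=c_{\sqrt{\ }}(a_1^2,a_2^2)\,c_{\sqrt{\ }}(a_1^2a_2^2,c'(\dot t_1,\dot t_2))$, a 2-cocycle on $F^\times$ with values in $\{\pm1\}$. $\widetilde{\mathrm{GSp}}(W)$ is the set of $[g,\epsilon]$, $g\in\mathrm{GSp}(W)$, $\epsilon\in\{\pm1\}$, with product $[g_1,\epsilon_1][g_2,\epsilon_2]=[g_1g_2,c'''(\lambda_{g_1},\lambda_{g_2})\epsilon_1\epsilon_2]$. The map $\nu:\widetilde{F^{\times2}}\to\widetilde{\mathrm{GSp}}(W)$, $[a,\epsilon]\mapsto[\sqrt a\,\epsilon,\epsilon]$ (with $\sqrt a\,\epsilon$ a scalar similitude) is an injective homomorphism with central image. *)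

(* Defs.v *)
From HB Require Import structures.
From mathcomp Require Import all_boot all_order all_algebra.
From mathcomp Require Import all_fingroup all_solvable all_field all_character.
From mathcomp Require Import ring.

Set Implicit Arguments.
Unset Strict Implicit.
Unset Printing Implicit Defensive.

Import GroupScope GRing.Theory.
Local Open Scope ring_scope.

(* An mx_representation rG is used through its action v |-> rG g *m v on
   column vectors. *)

Section Ind.
Variables (C : fieldType) (gT : finGroupType) (G H : {group gT}).
Variables (n : nat) (rH : mx_representation C H n).

Definition ind_index : finType :=
  ({A : {set gT} | A \in rcosets H G} * 'I_n)%type.

(* Ind_H^G V is the space of f : G -> V with f (h x) = rH h (f x) for h in H,
   on which G acts by (g f)(x) = f (x g).  Such an f is given by its values
   f (repr A) on representatives of the cosets A in H\G, and
   (g f)(repr A) = rH h (f (repr B)) when repr A * g = h * repr B, h in H. *)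
Definition ind_mx (g : gT) : 'M[C]_(#|ind_index|) :=
  \matrix_(i, j)
    let: (A, k) := enum_val i in
    let: (B, l) := enum_val j in
    let h := (repr (val A) * g * (repr (val B))^-1)%g in
    if h \in H then rH h k l else 0.

Hypothesis sHG : H \subset G.

Lemma ind_mx_repr : mx_repr G ind_mx.
Proof.
have rcE A : A \in rcosets H G -> A = H :* repr A.
  by case/rcosetsP=> x _ ->; rewrite rcoset_repr.
split=> [|x y Gx Gy].
  apply/matrixP=> i j; rewrite !mxE.
  rewrite -[in RHS](inj_eq enum_val_inj).
  case: (enum_val i) (enum_val j) => [[A HA] k] [[B HB] l] /=.
  rewrite mulg1 -mem_rcoset; have [eqAB|neqAB] := eqVneq A B.
    subst B; have -> : HA = HB by apply: bool_irrelevance.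
    rewrite mem_rcoset mulgV group1 repr_mx1 mxE.
    by rewrite -pair_eqE /= eqxx.
  rewrite -pair_eqE /= -val_eqE /= (negPf neqAB) /= mulr0n; case: ifP => // rAB; case/eqP: neqAB.
  by rewrite (rcE A) // (rcE B) //; apply/rcoset_eqP.
apply/matrixP=> i j; rewrite !mxE.
case Di: (enum_val i) => [[A HA] k]; case Dj: (enum_val j) => [[B HB] l] /=.
have GA : repr A \in G.
  case/rcosetsP: (HA) => z Gz DA.
  have: repr A \in H :* z by rewrite DA mem_repr_rcoset.
  by case/rcosetP=> h Hh ->; apply: groupM => //; apply: (subsetP sHG).
have HD : H :* (repr A * x) \in rcosets H G.
  by rewrite mem_rcosets mulSGid // groupM.
pose D : {A : {set gT} | A \in rcosets H G} :=
  exist (fun A : {set gT} => A \in rcosets H G) _ HD.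
under eq_bigr do rewrite !mxE Di Dj.
rewrite (reindex (@enum_rank ind_index)) /=; last first.
  by apply: onW_bij; apply: enum_rank_bij.
under eq_bigr do rewrite enum_rankK.
pose F (E : {A : {set gT} | A \in rcosets H G}) (l0 : 'I_n) : C :=
  (if (repr A * x * (repr (val E))^-1)%g \in H
   then rH (repr A * x * (repr (val E))^-1)%g k l0 else 0) *
  (if (repr (val E) * y * (repr B)^-1)%g \in H
   then rH (repr (val E) * y * (repr B)^-1)%g l0 l else 0).
rewrite (eq_bigr (fun p => F p.1 p.2)) => [|[E l0] _ //].
rewrite -(pair_bigA _ F) /F {F} /=.
rewrite (bigD1 D) //= [X in _ + X]big1 ?addr0 => [|E neqED]; last first.
  apply: big1 => l0 _; case: ifP => [HE|]; last by rewrite mul0r.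
  case/eqP: neqED; apply: val_inj => /=.
  rewrite (rcE _ (valP E)); apply/esym/rcoset_eqP.
  by rewrite mem_rcoset.
have HDx : (repr A * x * (repr (H :* (repr A * x)))^-1)%g \in H.
  have: repr (H :* (repr A * x)) \in H :* (repr A * x) by rewrite mem_repr_rcoset.
  by case/rcosetP=> h Hh ->; rewrite invMg mulKVg groupV.
pose h1 := (repr A * x * (repr (H :* (repr A * x)))^-1)%g.
pose h2 := (repr (H :* (repr A * x)) * y * (repr B)^-1)%g.
rewrite -/h1 -/h2 in HDx *.
have Dh : (repr A * (x * y) * (repr B)^-1 = h1 * h2)%g.
  by rewrite /h1 /h2 !mulgA !mulgKV.
rewrite Dh groupMl //; case: ifP => Hh2.
  by rewrite repr_mxM // mxE; apply: eq_bigr => l0 _; rewrite HDx.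
by rewrite big1 // => l0 _; rewrite mulr0.
Qed.

Definition ind_repr := MxRepresentation ind_mx_repr.

End Ind.

Section Transport.
Variables (C : fieldType) (aT rT : finGroupType) (D : {group aT}).
Variables (f : {morphism D >-> rT}) (injf : 'injm f).
Variables (n : nat) (rD : mx_representation C D n).

Lemma transport_mx_repr : mx_repr (f @* D) (rD \o invm injf).
Proof.
split=> [|x y fx fy] /=; first by rewrite morph1 repr_mx1.
have im z : z \in f @* D -> invm injf z \in D.
  by move=> fz; rewrite -(im_invm injf) mem_morphim.
by rewrite morphM // repr_mxM ?im.
Qed.
Definition transport_repr := MxRepresentation transport_mx_repr.
End Transport.

(* m > 0, as the similitude factor is not defined on the zero space. *)
Record symplSpace (F : finFieldType) (m : nat) := SymplSpace {
  sympl_vect :> vectType F;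
  sympl_form : {skew_symmetric sympl_vect};
  sympl_axiom : is_psymplectic sympl_form;
  sympl_gt0 : (0 < m)%N;
  sympl_dim : \dim {:sympl_vect} = m.*2
}.

Section Similitudes.
Variables (F : finFieldType) (m : nat) (W : symplSpace F m).

(* Automorphisms of W are permutations of its (finite) set of vectors. As
   (g * h)%g x = h (g x) in {perm _}, this group acts on W on the right:
   g x stands for the vector x g. *)
Local Notation W' := (finvect_type W).
Local Notation B := (sympl_form W).
Implicit Types (g h : {perm W'}) (u v w : W').

Definition linear_perm g :=
  [forall a : F, forall u, forall v, g (a *: u + v) == a *: g u + g v].

Definition is_similitude g (l : F) :=
  (l != 0) && [forall u, forall v, B (g u) (g v) == l * B u v].

Definition GSp_set : {set {perm W'}} :=
  [set g | linear_perm g && [exists l, is_similitude g l]].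

Definition sim_factor g : F := odflt 1 [pick l | is_similitude g l].

Definition Sp_set : {set {perm W'}} :=
  [set g | linear_perm g && [forall u, forall v, B (g u) (g v) == B u v]].

Lemma linear_permP g :
  reflect (forall (a : F) u v, g (a *: u + v) = a *: g u + g v) (linear_perm g).
Proof.
apply: (iffP forallP) => [H a u v | H a]; first by have /forallP/(_ u)/forallP/(_ v)/eqP := H a.
by apply/forallP=> u; apply/forallP=> v; apply/eqP.
Qed.

Lemma is_similitudeP g (l : F) :
  reflect (l != 0 /\ forall u v, B (g u) (g v) = l * B u v) (is_similitude g l).
Proof.
apply: (iffP andP) => -[nzl H]; split=> //.
  by move=> u v; have /forallP/(_ u)/forallP/(_ v)/eqP := H.
by apply/forallP=> u; apply/forallP=> v; apply/eqP.
Qed.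

Lemma GSpP g :
  reflect (linear_perm g /\ exists l, is_similitude g l) (g \in GSp_set).
Proof. by rewrite inE; apply: (iffP andP) => -[? /existsP]. Qed.

Lemma sympl_form_neq0 : exists u v, B u v != 0.
Proof.
have dim_gt0 : (0 < \dim {:W})%N by rewrite (sympl_dim W) double_gt0 (sympl_gt0 W).
have nz : {:W}%VS != 0%VS by rewrite -dimv_eq0 -lt0n.
have [/eqP nd _ _] := sympl_axiom W.
have: vpick {:W} \notin orthov B fullv by rewrite nd memv0 vpick0.
by case/mem_orthovPn=> v _ Huv; exists (vpick {:W}), v.
Qed.

Lemma sim_factor_eq g l : is_similitude g l -> sim_factor g = l.
Proof.
move=> sgl; rewrite /sim_factor; case: pickP => [k sgk|/(_ l)]; last by rewrite sgl.
have [u [v nz]] := sympl_form_neq0.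
have [_ /(_ u v) Ek] := is_similitudeP _ _ sgk.
have [_ /(_ u v)] := is_similitudeP _ _ sgl.
by rewrite Ek => /(mulIf nz).
Qed.

Lemma sim_factorP g : g \in GSp_set -> is_similitude g (sim_factor g).
Proof. by case/GSpP=> _ [l sgl]; rewrite (sim_factor_eq sgl). Qed.

Lemma linear_perm1 : linear_perm 1.
Proof. by apply/linear_permP=> a u v; rewrite !perm1. Qed.

Lemma linear_permM g h : linear_perm g -> linear_perm h -> linear_perm (g * h).
Proof.
by move=> /linear_permP Hg /linear_permP Hh; apply/linear_permP=> a u v; rewrite !permM Hg Hh.
Qed.

Lemma is_similitude1 : is_similitude 1 1.
Proof.
by apply/is_similitudeP; split=> [|u v]; rewrite ?oner_neq0 // !perm1 mul1r.
Qed.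

Lemma is_similitudeM g h k l :
  is_similitude g k -> is_similitude h l -> is_similitude (g * h) (k * l).
Proof.
move=> /is_similitudeP[nzk Hg] /is_similitudeP[nzl Hh]; apply/is_similitudeP.
by split=> [|u v]; rewrite ?mulf_neq0 // !permM Hh Hg mulrCA mulrA.
Qed.

Lemma GSp_group_set : group_set GSp_set.
Proof.
apply/group_setP; split=> [|g h /GSpP[Lg [k Sg]] /GSpP[Lh [l Sh]]].
  by apply/GSpP; split; [exact: linear_perm1 | exists 1; exact: is_similitude1].
apply/GSpP; split; first exact: linear_permM.
by exists (k * l); exact: is_similitudeM.
Qed.
Canonical GSp := Group GSp_group_set.

Lemma SpP g :
  reflect (linear_perm g /\ is_similitude g 1) (g \in Sp_set).
Proof.
rewrite inE; apply: (iffP andP) => -[Lg].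
  move=> /forallP H; split=> //; apply/is_similitudeP; split=> [|u v].
    exact: oner_neq0.
  by rewrite mul1r; have /forallP/(_ v)/eqP := H u.
move=> /is_similitudeP[_ H]; split=> //.
by apply/forallP=> u; apply/forallP=> v; rewrite H mul1r.
Qed.

Lemma Sp_group_set : group_set Sp_set.
Proof.
apply/group_setP; split=> [|g h /SpP[Lg Sg] /SpP[Lh Sh]]; apply/SpP.
  by split; [exact: linear_perm1 | exact: is_similitude1].
by split; [exact: linear_permM | rewrite -[1]mulr1; exact: is_similitudeM].
Qed.
Canonical Sp := Group Sp_group_set.

Lemma Sp_sub_GSp : Sp \subset GSp.
Proof. by apply/subsetP=> g /SpP[Lg Sg]; apply/GSpP; split=> //; exists 1. Qed.

Lemma sim_factorM : {in GSp &, {morph sim_factor : g h / (g * h)%g >-> g * h}}.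
Proof.
move=> g h Gg Gh; apply: sim_factor_eq.
by apply: is_similitudeM; apply: sim_factorP.
Qed.

Lemma sim_factor_neq0 g : g \in GSp -> sim_factor g != 0.
Proof. by case/sim_factorP/is_similitudeP. Qed.

Lemma sim_factor_Sp g : g \in Sp -> sim_factor g = 1.
Proof. by case/SpP=> _ /sim_factor_eq. Qed.

Lemma scal_fun_inj (c : F) :
  injective (fun w : W' => if c == 0 then w else c *: w).
Proof.
move=> u v /=; case: eqP => // /eqP nzc Huv.
by rewrite -[u](scalerK nzc) Huv scalerK.
Qed.

(* The homothety of ratio c (a similitude of factor c ^+ 2) for c != 0. *)
Definition scal_perm (c : F) : {perm W'} := perm (@scal_fun_inj c).

Lemma scal_permE (c : F) w : c != 0 -> scal_perm c w = c *: w.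
Proof. by move=> nzc; rewrite permE (negPf nzc). Qed.

Lemma scal_perm_linear (c : F) : c != 0 -> linear_perm (scal_perm c).
Proof.
move=> nzc; apply/linear_permP=> a u v.
by rewrite !scal_permE // scalerDr !scalerA mulrC.
Qed.

Lemma scal_perm_sim (c : F) : c != 0 -> is_similitude (scal_perm c) (c ^+ 2).
Proof.
move=> nzc; apply/is_similitudeP; rewrite expf_neq0 //; split=> // u v.
by rewrite !scal_permE // linearZl_LR linearZr_LR /= mulrA.
Qed.

Lemma scal_perm_GSp (c : F) : c != 0 -> scal_perm c \in GSp.
Proof.
move=> nzc; apply/GSpP; split; first exact: scal_perm_linear.
by exists (c ^+ 2); apply: scal_perm_sim.
Qed.

Lemma scal_permM (c d : F) :
  c != 0 -> d != 0 -> (scal_perm c * scal_perm d)%g = scal_perm (c * d).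
Proof.
move=> nzc nzd; apply/permP=> w; rewrite permM !scal_permE ?mulf_neq0 //.
by rewrite scalerA mulrC.
Qed.

Lemma scal_perm1 : scal_perm 1 = 1%g.
Proof. by apply/permP=> w; rewrite scal_permE ?oner_neq0 // scale1r perm1. Qed.

Lemma scal_perm_inj (c : F) : c != 0 -> scal_perm c = 1%g -> c = 1.
Proof.
move=> nzc Ec; have [u [v nz]] := sympl_form_neq0.
apply/eqP; rewrite -subr_eq0; apply: contraNT nz => nzc1.
have /eqP : (c - 1) *: u = 0.
  by rewrite scalerBl scale1r -[c *: u](scal_permE _ nzc) Ec perm1 subrr.
by rewrite scaler_eq0 (negPf nzc1) /= => /eqP->; rewrite linear0l.
Qed.

Lemma scal_permC (c : F) g : c != 0 -> g \in GSp -> commute (scal_perm c) g.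
Proof.
move=> nzc /GSpP[/linear_permP Lg _]; apply/permP=> w; rewrite !permM !scal_permE //.
have L0 : g 0 = 0.
  have := Lg 1 0 0; rewrite !scale1r addr0 => /eqP.
  by rewrite -subr_eq0 opprD addrA subrr add0r oppr_eq0 => /eqP.
by rewrite -[c *: w]addr0 Lg L0 addr0.
Qed.

End Similitudes.

(* The choices of the map sqrt and of xi.  With q - 1 = 2 ^ n * l, l odd,
   (q - 1)`_2 = 2 ^ n, so that cv_xi_pow says that xi is in F_{2^n}. *)
Record coverData (F : finFieldType) := CoverData {
  cv_sqrt : F -> F;
  cv_sqrtK : forall a, a != 0 -> cv_sqrt (a ^+ 2) ^+ 2 = a ^+ 2;
  cv_sqrt1 : cv_sqrt 1 = 1;
  cv_xi : F;
  cv_xi_pow : cv_xi ^+ ((#|F|.-1)`_2)%N = 1;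
  cv_xi_nonsq : forall b, cv_xi != b ^+ 2
}.

Definition is_square (F : finFieldType) (a : F) := [exists b, a == b ^+ 2].

Section Cocycle.
Variables (F : finFieldType) (c : coverData F).
Implicit Types a b t : F.
Local Notation sqrt := (cv_sqrt c).
Local Notation xi := (cv_xi c).

(* {+1, -1} is represented by bool: e stands for (-1) ^+ e. *)
(* sqrt a * sqrt b = (-1) ^+ c_sqrt a b * sqrt (a * b) on squares (c_sqrtE). *)
Definition c_sqrt a b : bool := sqrt a * sqrt b != sqrt (a * b).

Definition kappa t : F := if is_square t then 1 else xi.
Definition c' t1 t2 : F := kappa t1 * kappa t2 / kappa (t1 * t2).

(* t / kappa t is the square a ^+ 2 such that t = a ^+ 2 * kappa t. *)
Definition c''' t1 t2 : bool :=
  c_sqrt (t1 / kappa t1) (t2 / kappa t2)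
  (+) c_sqrt (t1 / kappa t1 * (t2 / kappa t2)) (c' t1 t2).

Lemma is_squareP a : reflect (exists b, a = b ^+ 2) (is_square a).
Proof. by apply: (iffP existsP) => -[b /eqP Hb]; exists b; rewrite ?Hb. Qed.

Lemma xi_nsq : is_square xi = false.
Proof. by apply/existsP=> -[b /eqP Hb]; have := cv_xi_nonsq c b; rewrite {1}Hb eqxx. Qed.

Lemma xi_neq0 : xi != 0.
Proof. by apply: contraFN xi_nsq => /eqP->; apply/is_squareP; exists 0; rewrite expr0n. Qed.

Lemma kappa_neq0 t : kappa t != 0.
Proof. by rewrite /kappa; case: ifP; rewrite ?oner_neq0 ?xi_neq0. Qed.

Lemma neg1_neq1 : (-1 : F) != 1.
Proof.
apply/eqP => E.
have sq_inj : injective (fun x : F => x ^+ 2).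
  move=> x y /eqP; rewrite eqf_sqr => /orP[/eqP //|/eqP->].
  by rewrite -mulN1r E mul1r.
have: xi \in codom (fun x : F => x ^+ 2).
  by have [g _ K] := injF_bij sq_inj; rewrite -[xi]K; apply: codom_f.
by case/codomP=> b Hb; have := cv_xi_nonsq c b; rewrite {1}Hb eqxx.
Qed.

Lemma is_squareM s t : is_square s -> is_square (s * t) = (s == 0) || is_square t.
Proof.
case/is_squareP=> a ->; have [->|nza] := eqVneq (a ^+ 2) 0.
  have sq0 : is_square (0 : F) by apply/is_squareP; exists 0; rewrite expr0n.
  by rewrite mul0r sq0.
apply/is_squareP/is_squareP => -[b Hb]; last by exists (a * b); rewrite exprMn Hb.
exists (b / a); rewrite expr_div_n -Hb mulrC mulKf //.
Qed.

Lemma nonsqM s t : is_square s = false -> is_square t = false -> is_square (s * t).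
Proof.
move=> ns nt.
have nz (x : F) : is_square x = false -> x != 0.
  by move=> nx; apply: contraFN nx => /eqP->; apply/is_squareP; exists 0; rewrite expr0n.
have us : s \is a GRing.unit by rewrite unitfE nz.
have ut : t \is a GRing.unit by rewrite unitfE nz.
have /cyclicP[u Du] := field_unit_group_cyclic [set: {unit F}]%G.
have par (x : F) (ux : x \is a GRing.unit) :
    is_square x = false -> exists i, x = val u ^+ (i.*2.+1).
  move=> nx; have: FinRing.unit F ux \in <[u]>%g by rewrite -Du inE.
  case/cycleP=> i /(congr1 val) /=; rewrite FinRing.val_unitX => Ei.
  case oi: (odd i); first by exists i./2; rewrite -[RHS]/(_ ^+ (true + _)) -oi odd_double_half.
  case/is_squareP: nx; exists (val u ^+ i./2).
  by rewrite -exprM muln2 Ei -{1}(odd_double_half i) oi.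
have [i ->] := par s us ns; have [j ->] := par t ut nt.
apply/is_squareP; exists (val u ^+ (i + j).+1).
by rewrite -exprM -exprD muln2 doubleS doubleD addSn addnS.
Qed.

Lemma is_squareMnz s t : s != 0 -> t != 0 ->
  ~~ is_square (s * t) = ~~ is_square s (+) ~~ is_square t.
Proof.
move=> nzs nzt; case Hs: (is_square s); first by rewrite is_squareM // (negPf nzs).
case Ht: (is_square t) => /=; last by rewrite nonsqM.
by rewrite mulrC is_squareM // (negPf nzt) Hs.
Qed.

Lemma divkappa_sq t : is_square (t / kappa t).
Proof.
rewrite /kappa; case Ht: (is_square t); first by rewrite divr1.
case/is_squareP: (nonsqM Ht xi_nsq) => b Hb; apply/is_squareP; exists (b / xi).
by rewrite expr_div_n -Hb; field; rewrite xi_neq0.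
Qed.

Lemma c'_E t1 t2 : t1 != 0 -> t2 != 0 ->
  c' t1 t2 = if ~~ is_square t1 && ~~ is_square t2 then xi ^+ 2 else 1.
Proof.
move=> nz1 nz2; have := is_squareMnz nz1 nz2; rewrite /c' /kappa.
by case: (is_square t1); case: (is_square t2); case: (is_square _) => //= _; rewrite ?divr1 ?mulr1 ?mul1r ?mulfV ?xi_neq0 ?oner_neq0.
Qed.

Lemma sqrt_sq a : a != 0 -> is_square a -> sqrt a ^+ 2 = a.
Proof.
move=> nza /is_squareP[b Db]; rewrite Db cv_sqrtK //.
by apply: contraNneq nza => b0; rewrite Db b0 expr0n.
Qed.

Lemma sqrt_neq0 a : a != 0 -> is_square a -> sqrt a != 0.
Proof. by move=> nza sa; rewrite -sqrf_eq0 sqrt_sq. Qed.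

Lemma c_sqrtE a b : a != 0 -> b != 0 -> is_square a -> is_square b ->
  sqrt a * sqrt b = (-1) ^+ c_sqrt a b * sqrt (a * b).
Proof.
move=> nza nzb sa sb; have sab : is_square (a * b) by rewrite is_squareM // sb orbT.
have /eqP : (sqrt a * sqrt b) ^+ 2 = sqrt (a * b) ^+ 2.
  by rewrite exprMn !sqrt_sq ?mulf_neq0.
rewrite /c_sqrt eqf_sqr; case: eqP => /= [->|_ /eqP->]; rewrite ?mul1r //.
by rewrite expr1 mulN1r.
Qed.

Lemma signF_inj (b1 b2 : bool) : (-1) ^+ b1 = (-1) ^+ b2 :> F -> b1 = b2.
Proof.
have := neg1_neq1; case: b1; case: b2 => //=; rewrite expr0 expr1 => /eqP //.
by move=> H /esym.
Qed.

Lemma c'''E t1 t2 : t1 != 0 -> t2 != 0 ->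
  sqrt (t1 / kappa t1) * sqrt (t2 / kappa t2) * sqrt (c' t1 t2) =
  (-1) ^+ c''' t1 t2 * sqrt (t1 * t2 / kappa (t1 * t2)).
Proof.
move=> nz1 nz2.
have nzk t : t != 0 -> t / kappa t != 0 by move=> nzt; rewrite mulf_neq0 ?invr_eq0 ?kappa_neq0.
have nzc' : c' t1 t2 != 0 by rewrite !mulf_neq0 ?invr_eq0 ?kappa_neq0.
have sc' : is_square (c' t1 t2).
  rewrite c'_E //; case: ifP => _; apply/is_squareP; first by exists xi.
  by exists 1; rewrite expr1n.
have s12 : is_square (t1 / kappa t1 * (t2 / kappa t2)).
  by rewrite is_squareM ?divkappa_sq ?orbT.
have E1 := c_sqrtE (nzk _ nz1) (nzk _ nz2) (divkappa_sq t1) (divkappa_sq t2).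
have E2 := c_sqrtE (mulf_neq0 (nzk _ nz1) (nzk _ nz2)) nzc' s12 sc'.
rewrite E1 -[LHS]mulrA E2 mulrA -signr_addb; congr (_ * sqrt _); rewrite /c'.
by field; rewrite !kappa_neq0.
Qed.

Lemma c'''_cocycle t1 t2 t3 : t1 != 0 -> t2 != 0 -> t3 != 0 ->
  c''' t1 t2 (+) c''' (t1 * t2) t3 = c''' t2 t3 (+) c''' t1 (t2 * t3).
Proof.
move=> nz1 nz2 nz3; apply: signF_inj; rewrite [LHS]signr_addb [RHS]signr_addb.
have nzk t : t != 0 -> t / kappa t != 0 by move=> nzt; rewrite mulf_neq0 ?invr_eq0 ?kappa_neq0.
have nzs t : t != 0 -> sqrt (t / kappa t) != 0.
  by move=> nzt; rewrite sqrt_neq0 ?nzk ?divkappa_sq.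
have E12 := c'''E nz1 nz2; have E23 := c'''E nz2 nz3.
have nz12 := mulf_neq0 nz1 nz2; have nz23 := mulf_neq0 nz2 nz3.
have E12_3 := c'''E nz12 nz3; have E1_23 := c'''E nz1 nz23.
have dd : sqrt (c' t1 t2) * sqrt (c' (t1 * t2) t3) = sqrt (c' t2 t3) * sqrt (c' t1 (t2 * t3)).
  rewrite !c'_E // !is_squareMnz //.
  by case: (is_square t1); case: (is_square t2); case: (is_square t3) => //=;
    rewrite ?cv_sqrt1 ?mulr1 ?mul1r.
set s1 := sqrt (t1 / _) in E12 E1_23; set s2 := sqrt (t2 / _) in E12 E23.
set s3 := sqrt (t3 / _) in E12_3 E23.
have nz := nzs _ (mulf_neq0 nz12 nz3).
apply: (mulIf nz).
have -> : (-1) ^+ c''' t1 t2 * (-1) ^+ c''' (t1 * t2) t3 * sqrt (t1 * t2 * t3 / kappa (t1 * t2 * t3))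
   = s1 * s2 * s3 * (sqrt (c' t1 t2) * sqrt (c' (t1 * t2) t3)).
  by rewrite -[LHS]mulrA -E12_3 !mulrA -E12; ring.
have -> : (-1) ^+ c''' t2 t3 * (-1) ^+ c''' t1 (t2 * t3) * sqrt (t1 * t2 * t3 / kappa (t1 * t2 * t3))
   = s1 * s2 * s3 * (sqrt (c' t2 t3) * sqrt (c' t1 (t2 * t3))).
  rewrite -[t1 * t2 * t3]mulrA -[LHS]mulrA -E1_23.
  transitivity ((-1) ^+ c''' t2 t3 * sqrt (t2 * t3 / kappa (t2 * t3)) * s1 * sqrt (c' t1 (t2 * t3))).
    by ring.
  by rewrite -E23; ring.
by rewrite dd.
Qed.

Lemma c'''C t1 t2 : c''' t1 t2 = c''' t2 t1.
Proof.
rewrite /c''' /c' /c_sqrt [t2 * t1]mulrC [kappa t2 * _]mulrC.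
by rewrite [t2 / _ * (t1 / _)]mulrC [sqrt (t2 / _) * _]mulrC.
Qed.

Lemma is_square1 : is_square (1 : F).
Proof. by apply/is_squareP; exists 1; rewrite expr1n. Qed.

Lemma c'''_sq t1 t2 : is_square t1 -> t1 != 0 -> is_square t2 ->
  c''' t1 t2 = c_sqrt t1 t2.
Proof.
move=> s1 nz1 s2; rewrite /c''' /c' /kappa is_squareM // s1 s2 orbT !divr1.
by rewrite mulr1 {2}/c_sqrt cv_sqrt1 !mulr1 eqxx addbF.
Qed.

Lemma c'''1 t : c''' 1 t = false.
Proof.
have k1 : kappa 1 = 1 by rewrite /kappa is_square1.
rewrite /c''' /c' k1 divr1 !mul1r mulfV ?kappa_neq0 //.
by rewrite /c_sqrt cv_sqrt1 !mul1r !mulr1 !eqxx.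
Qed.

End Cocycle.

Section Cover.
Variables (F : finFieldType) (c : coverData F) (m : nat) (W : symplSpace F m).
Local Notation G := (GSp W).
Local Notation la := (@sim_factor F m W).

Record tGSp : predArgType := TGSp { tGSp_pair : subg_of G * bool }.
HB.instance Definition _ := [isNew for tGSp_pair].
HB.instance Definition _ := [Finite of tGSp by <:].
Implicit Types x y z : tGSp.

(* [g, e] for g in GSp(W); for other g it is junk. *)
Definition tGSp_mk (g : {perm finvect_type W}) (e : bool) : tGSp :=
  TGSp (subg G g, e).
Definition tval x : {perm finvect_type W} := sgval (tGSp_pair x).1.
Definition tsgn x : bool := (tGSp_pair x).2.

Definition tGSp_mul x y : tGSp :=
  tGSp_mk (tval x * tval y) (c''' c (la (tval x)) (la (tval y)) (+) (tsgn x (+) tsgn y)).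
Definition tGSp_one : tGSp := tGSp_mk 1 false.
Definition tGSp_inv x : tGSp :=
  tGSp_mk (tval x)^-1 (c''' c (la (tval x)^-1) (la (tval x)) (+) tsgn x).

Lemma tval_GSp x : tval x \in G.
Proof. exact: subgP. Qed.

Lemma tval_mk g e : g \in G -> tval (tGSp_mk g e) = g.
Proof. exact: subgK. Qed.

Lemma tsgn_mk g e : tsgn (tGSp_mk g e) = e.
Proof. by []. Qed.

Lemma tGSp_eqP x y : tval x = tval y -> tsgn x = tsgn y -> x = y.
Proof.
case: x y => [[g e]] [[h f]]; rewrite /tval /tsgn /= => Egh ->.
by rewrite (val_inj Egh).
Qed.

Lemma tval_mul x y : tval (tGSp_mul x y) = (tval x * tval y)%g.
Proof. by rewrite tval_mk // groupM ?tval_GSp. Qed.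

Lemma la_neq0 x : la (tval x) != 0.
Proof. exact/sim_factor_neq0/tval_GSp. Qed.

Lemma la1 : la 1 = 1.
Proof. exact/sim_factor_Sp/group1. Qed.

Lemma tGSp_mulA : associative tGSp_mul.
Proof.
move=> x y z; apply: tGSp_eqP; first by rewrite !tval_mul mulgA.
rewrite !tsgn_mk !tval_mul !sim_factorM ?tval_GSp //.
have := c'''_cocycle c (la_neq0 x) (la_neq0 y) (la_neq0 z).
set a := c''' c (la (tval x)) (la (tval y)); set b := c''' _ (_ * _) _.
set d := c''' c (la (tval y)) _; set e := c''' _ _ (_ * _).
by case: a; case: b; case: d; case: e => //= _;
   case: (tsgn x); case: (tsgn y); case: (tsgn z).
Qed.

Lemma tGSp_mul1 : left_id tGSp_one tGSp_mul.
Proof.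
move=> x; apply: tGSp_eqP; first by rewrite tval_mul tval_mk // mul1g.
by rewrite !tsgn_mk tval_mk // la1 c'''1.
Qed.

Lemma tGSp_mulV : left_inverse tGSp_one tGSp_inv tGSp_mul.
Proof.
move=> x; have GV : (tval x)^-1%g \in G by rewrite groupV tval_GSp.
apply: tGSp_eqP; first by rewrite tval_mul !tval_mk // mulVg.
by rewrite !tsgn_mk !tval_mk // -addbA addbb addbF addbb.
Qed.

HB.instance Definition _ :=
  Finite_isGroup.Build tGSp tGSp_mulA tGSp_mul1 tGSp_mulV.

(* nu [a, e] = [sqrt a * e, e]; the elements of the extension of F^x2 by
   {+1, -1} are the pairs (a, e), a in F^x2. *)
Definition nz_squares : {set F} := [set a | (a != 0) && is_square a].

Definition nu (p : F * bool) : tGSp :=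
  tGSp_mk (scal_perm W (cv_sqrt c p.1 * (-1) ^+ p.2)) p.2.

Definition nu_set : {set tGSp} := nu @: setX nz_squares setT.

Lemma nu_scal_neq0 a (e : bool) :
  a \in nz_squares -> cv_sqrt c a * (-1) ^+ e != 0.
Proof.
by rewrite inE => /andP[nza sa]; rewrite mulf_neq0 ?signr_eq0 ?sqrt_neq0.
Qed.

Lemma tval_nu a (e : bool) : a \in nz_squares ->
  tval (nu (a, e)) = scal_perm W (cv_sqrt c a * (-1) ^+ e).
Proof. by move=> sa; rewrite tval_mk // scal_perm_GSp // nu_scal_neq0. Qed.

Lemma la_nu a (e : bool) : a \in nz_squares -> la (tval (nu (a, e))) = a.
Proof.
move=> sa; rewrite tval_nu // (sim_factor_eq (scal_perm_sim _ _)) ?nu_scal_neq0 //.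
move: sa; rewrite inE => /andP[nza sa].
by rewrite exprMn sqrt_sq // -exprM mulnC exprM sqrrN expr1n expr1n mulr1.
Qed.

Lemma nuM a b (e f : bool) : a \in nz_squares -> b \in nz_squares ->
  (nu (a, e) * nu (b, f))%g = nu (a * b, c_sqrt c a b (+) (e (+) f)).
Proof.
move=> sa sb; have [/andP[nza qa] /andP[nzb qb]] : (a != 0) && is_square a /\ (b != 0) && is_square b.
  by move: sa sb; rewrite !inE.
have sab : a * b \in nz_squares by rewrite inE mulf_neq0 //= is_squareM // qb orbT.
apply: tGSp_eqP.
  rewrite tval_mul !tval_nu // scal_permM ?nu_scal_neq0 //; congr (scal_perm _ _).
  by rewrite mulrACA c_sqrtE // !signr_addb; ring.
by rewrite tsgn_mk !la_nu // c'''_sq.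
Qed.

Lemma nu_group_set : group_set nu_set.
Proof.
apply/group_setP; split=> [|x y].
  have s1 : 1 \in nz_squares by rewrite inE oner_neq0 is_square1.
  apply/imsetP; exists (1, false); first by rewrite inE s1 inE.
  apply: tGSp_eqP; last by rewrite !tsgn_mk.
  by rewrite tval_nu // tval_mk // cv_sqrt1 mulr1 scal_perm1.
case/imsetP=> -[a e] /setXP[/= sa _] -> /imsetP[[b f] /setXP[/= sb _] ->].
rewrite nuM //; apply: imset_f; apply/setXP; rewrite inE; split=> //=.
move: sa sb; rewrite !inE => /andP[nza qa] /andP[nzb qb].
by rewrite mulf_neq0 //= is_squareM // qb orbT.
Qed.
Canonical nu_group := Group nu_group_set.

Lemma nu_central x y : x \in nu_set -> (x * y = y * x)%g.
Proof.
case/imsetP=> -[a e] /setXP[/= sa _] ->; apply: tGSp_eqP.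
  by rewrite !tval_mul tval_nu // scal_permC ?tval_GSp ?nu_scal_neq0.
by rewrite !tsgn_mk c'''C [_ (+) tsgn y]addbC.
Qed.

Lemma norm_nu x : x \in 'N(nu_set).
Proof.
rewrite inE; apply/subsetP=> _ /imsetP[y nuy ->].
by rewrite conjgE (nu_central _ nuy) mulKg.
Qed.

Definition PGSp : {group coset_of nu_set} := ([set: tGSp] / nu_set)%G.

(* The embedding of Sp(W), sending g to the class of [g, 1]. *)
Definition Sp_emb (g : {perm finvect_type W}) : coset_of nu_set :=
  coset nu_set (tGSp_mk g false).

Lemma Sp_embM : {in Sp W &, {morph Sp_emb : g h / (g * h)%g}}.
Proof.
move=> g h Sg Sh; have [Gg Gh] := (subsetP (Sp_sub_GSp W) g Sg, subsetP (Sp_sub_GSp W) h Sh).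
rewrite /Sp_emb -morphM ?norm_nu //; congr (coset _ _).
apply: tGSp_eqP; first by rewrite tval_mul !tval_mk // groupM.
by rewrite !tsgn_mk !tval_mk // !sim_factor_Sp // c'''1.
Qed.
Canonical Sp_emb_morphism := Morphism Sp_embM.

Lemma Sp_emb_inj : 'injm Sp_emb.
Proof.
apply/subsetP=> g /morphpreP[Sg]; rewrite inE => /eqP Eg.
have Gg := subsetP (Sp_sub_GSp W) g Sg.
have /imsetP[[a e] /setXP[/= sa _] Dg] : tGSp_mk g false \in nu_group.
  by apply: coset_idr => //; apply: norm_nu.
have a1 : a = 1 by rewrite -(la_nu e sa) -Dg tval_mk // sim_factor_Sp.
have e0 : e = false by have := congr1 tsgn Dg; rewrite !tsgn_mk.
have := congr1 tval Dg; rewrite tval_nu // tval_mk // a1 e0 cv_sqrt1 mulr1 scal_perm1.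
by move->; rewrite inE.
Qed.

Lemma Sp_emb_sub : Sp_emb @* Sp W \subset PGSp.
Proof.
apply/subsetP=> _ /morphimP[g _ Sg ->].
by apply: mem_morphim; [exact: norm_nu | rewrite inE].
Qed.

(* Ind_{Sp(W)}^{PGSp(W)} pi, and its restriction to Sp(W). *)
Section Rho.
Variables (C : fieldType) (n : nat) (pi : mx_representation C (Sp W) n).

Definition rho := ind_repr (transport_repr Sp_emb_inj pi) Sp_emb_sub.

Definition rho_Sp : mx_representation C (Sp W) _ :=
  morphim_repr (subg_repr rho Sp_emb_sub) (subxx (Sp W)).
End Rho.

End Cover.

Arguments Sp_emb {F} c {m} W g.

Section Heisenberg.
Variables (F : finFieldType) (m : nat) (W : symplSpace F m).

Record Ha : predArgType := HaPair { Ha_pair : finvect_type W * F }.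
HB.instance Definition _ := [isNew for Ha_pair].
HB.instance Definition _ := [Finite of Ha by <:].

Definition Ha_mk (w : W) (t : F) : Ha := HaPair (w, t).
Definition Ha_vec (h : Ha) : W := (Ha_pair h).1.
Definition Ha_scal (h : Ha) : F := (Ha_pair h).2.

Definition Ha_mul (h h' : Ha) : Ha :=
  Ha_mk (Ha_vec h + Ha_vec h')
        (Ha_scal h + Ha_scal h' + 2^-1 * sympl_form W (Ha_vec h) (Ha_vec h')).
Definition Ha_one : Ha := Ha_mk 0 0.
Definition Ha_inv (h : Ha) : Ha :=
  Ha_mk (- Ha_vec h) (- Ha_scal h + 2^-1 * sympl_form W (Ha_vec h) (Ha_vec h)).

Lemma Ha_mulA : associative Ha_mul.
Proof.
case=> -[w1 t1] [[w2 t2]] [[w3 t3]]; rewrite /Ha_mul /Ha_vec /Ha_scal /= addrA.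
by rewrite linearDl linearDr /=; congr (Ha_mk _ _); ring.
Qed.

Lemma Ha_mul1 : left_id Ha_one Ha_mul.
Proof.
case=> -[w t]; rewrite /Ha_mul /Ha_one /Ha_vec /Ha_scal /= !add0r linear0l.
by rewrite mulr0 addr0.
Qed.

Lemma Ha_mulV : left_inverse Ha_one Ha_inv Ha_mul.
Proof.
case=> -[w t]; rewrite /Ha_mul /Ha_inv /Ha_vec /Ha_scal /= addNr linearNl.
by congr (Ha_mk _ _); ring.
Qed.

HB.instance Definition _ := Finite_isGroup.Build Ha Ha_mulA Ha_mul1 Ha_mulV.

(* The right action of Sp(W) on Ha(W) defining Sp(W) \ltimes Ha(W). *)
Definition Ha_act (g : {perm finvect_type W}) (h : Ha) : Ha :=
  Ha_mk (g (Ha_vec h)) (Ha_scal h).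

End Heisenberg.

Section Characters.
Variables (F : finFieldType) (C : fieldType).

Definition nontrivial_char (psi : F -> C) : Prop :=
  [/\ psi 0 = 1, forall s t, psi (s + t) = psi s * psi t
    & exists t, psi t != 1].

Definition char_scale (psi : F -> C) (a : F) : F -> C := fun t => psi (a * t).

Definition gauss_sum (psi : F -> C) : C := \sum_(x : F) psi (x ^+ 2 / 2).

Definition legendre (a : F) : C :=
  if a == 0 then 0 else if is_square a then 1 else -1.
End Characters.

(* A complete polarization W = X + X^* with a symplectic basis
   e_i (pol_e), e_i^* (pol_es). *)
Record polarization (F : finFieldType) (m : nat) (W : symplSpace F m) :=
  Polarization {
  pol_e : 'I_m -> W;
  pol_es : 'I_m -> W;
  pol_ee : forall i j, sympl_form W (pol_e i) (pol_e j) = 0;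
  pol_eses : forall i j, sympl_form W (pol_es i) (pol_es j) = 0;
  pol_ees : forall i j, sympl_form W (pol_e i) (pol_es j) = (i == j)%:R;
  pol_full :
    (<<codom pol_e>> + <<codom pol_es>> = {:sympl_vect W})%VS
}.

Section Weil.
Variables (F : finFieldType) (m : nat) (W : symplSpace F m).
Variables (P : polarization W) (C : fieldType).
Local Notation B := (sympl_form W).
Local Notation e := (pol_e P).
Local Notation es := (pol_es P).

Definition polX : {vspace W} := <<codom e>>%VS.
Definition polXs : {vspace W} := <<codom es>>%VS.

Definition setX_pol : {set finvect_type W} := [set x : finvect_type W | (x : W) \in polX].

(* C[X] as column vectors indexed by X. *)
Definition CX (f : W -> C) : 'cV[C]_#|setX_pol| :=
  \col_(i < #|setX_pol|) f (enum_val i : finvect_type W).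

(* The determinant of a in Aut(X), in the basis e_i, for the restriction a
   of g to X when g preserves X and X^*. *)
Definition det_X (g : {perm finvect_type W}) : F :=
  \det (\matrix_(i, j) B (g (e i)) (es j)).

Variable psi : F -> C.

(* The three formulas for the blocks (1 b; 0 1), (a 0; 0 a^{*-1}) and omega
   with respect to W = X + X^*. That b is symmetric, and that g acts on X^* as
   a^{*-1}, follows from g \in Sp W. *)
Definition weil_formulas (pi : {perm finvect_type W} -> 'M[C]_#|setX_pol|) : Prop :=
  [/\ forall (g : {perm finvect_type W}) (b : W -> W), g \in Sp W ->
        (forall x, x \in polX -> b x \in polXs /\ g x = x + b x) ->
        (forall x, x \in polXs -> g x = x) ->
        forall f : W -> C,
          pi g *m CX f = CX (fun y => psi (2^-1 * B y (b y)) * f y),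
      forall g : {perm finvect_type W}, g \in Sp W ->
        (forall x, x \in polX -> (g x : W) \in polX) ->
        (forall x, x \in polXs -> (g x : W) \in polXs) ->
        forall f : W -> C,
          pi g *m CX f = CX (fun y => legendre C (det_X g) * f (g y))
    & forall g : {perm finvect_type W}, g \in Sp W ->
        (forall i, g (e i) = - es i) -> (forall i, g (es i) = e i) ->
        forall f : W -> C,
          pi g *m CX f =
            CX (fun y => gauss_sum psi ^- m *
                   \sum_(x in setX_pol) f x * psi (B x (g y)))].

(* A representation of Sp(W) \ltimes Ha(W) is a pair of representations pi of
   Sp(W) and eta of Ha(W) on the same space such that pi g^-1 eta h pi g =
   eta h^g.  It is required to restrict to Ha(W) as the Heisenberg
   representation (the irreducible one of central character psi), and to be
   given on Sp(W) by the formulas of the Schroedinger model C[X]. *)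
Definition weil_repr (pi : mx_representation C (Sp W) #|setX_pol|) : Prop :=
  weil_formulas pi /\
  exists eta : mx_representation C [set: Ha W]%G #|setX_pol|,
    [/\ mx_irreducible eta,
        forall t, eta (Ha_mk 0 t) = (psi t)%:M
      & forall g h, g \in Sp W -> pi g *m eta (Ha_act g h) = eta h *m pi g].

End Weil.

(* Main.v *)
Require Import Defs.
From mathcomp Require Import all_boot all_order all_algebra.
From mathcomp Require Import all_fingroup all_solvable all_field all_character.
From mathcomp Require Import reals complex.
From mathcomp Require Import ring.

Set Implicit Arguments.
Unset Strict Implicit.
Unset Printing Implicit Defensive.

Import GroupScope GRing.Theory.
Local Open Scope ring_scope.

(** A similitude of factor t turns the Weil representation of psi into that of
psi^(1/t). This is all that happens here: a nontrivial character of F is some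
psi^b ([char_dual]), so every Weil representation is a twist of pi_psi by
conjugation by a similitude d of factor 1/b ([weil_twist]); the homotheties are
central, so a similitude of square factor acts on Sp(W) as an element of Sp(W)
and twisting by it changes nothing up to isomorphism ([twist_square_rsim]);
hence there are at most two classes, that of pi_psi and that of its twist by a
similitude of nonsquare factor. They are different since a transvection along a
vector of X^* has as its trace a positive multiple of the Gauss sum of psi,
which is nonzero and changes sign when psi becomes psi^a with a not a square
([trace_weil_transv], [weil_not_rsim]).

The formulas of the Schroedinger model determine a representation because Sp(W)
is generated by omega and the transvections along vectors of X^* ([Sp_gen]).
Thus [weil_twist] compares two representations on these generators only, where d
g d^-1 is again of a shape covered by the formulas: a transvection along the
same line, and omega times an element of the Levi subgroup, the Legendre symbol
of whose determinant accounts for the passage from the Gauss sum of psi to that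
of psi^b ([gauss_sum_scale]).

On the side of groups, the similitude factor modulo squares identifies the
quotient of PGSp by Sp(W) with F^x / F^x2, of order 2. For a normal subgroup H
of index 2 and x outside H, a representation induced from H restricts to it as
the sum of the representation and its twist by x: the values f(1) and f(x) of an
equivariant function f are the two components ([res_ind_index2]). Applied to the
class x of a similitude of nonsquare factor, this gives rho_psi = pi_psi +
pi_psi^a on Sp(W). The sum does not change up to isomorphism when pi_psi is
replaced by a twist ([rho_Sp_twist]), hence does not depend on psi. *)

(** * Twists, and restriction of an induced representation *)

Section Twist.
Variables (C : fieldType) (gT : finGroupType) (H : {group gT}).
Variables (n : nat) (rH : mx_representation C H n).

Lemma memJV_norm (x g : gT) : x \in 'N(H) -> g \in H -> (x * g * x^-1)%g \in H.
Proof.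
move=> nHx Hg; suff -> : (x * g * x^-1 = g ^ x^-1)%g by rewrite memJ_norm ?groupV.
by rewrite conjgE invgK mulgA.
Qed.

Lemma twist_mx_repr x : x \in 'N(H) -> mx_repr H (fun g => rH (x * g * x^-1)%g).
Proof.
move=> nHx; split=> [|g h Hg Hh]; first by rewrite mulg1 mulgV repr_mx1.
by rewrite -repr_mxM ?memJV_norm // !mulgA mulgKV.
Qed.
Definition twist_repr x (nHx : x \in 'N(H)) := MxRepresentation (twist_mx_repr nHx).

Lemma twist_rsim x (nHx : x \in 'N(H)) : x \in H -> mx_rsim (twist_repr nHx) rH.
Proof.
move=> Hx; exists (rH x) => // [|g Hg] /=.
  by rewrite row_free_unit repr_mx_unit.
by rewrite -!repr_mxM ?groupM ?groupV // mulgKV.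
Qed.
End Twist.

Section InducedRestriction.
Variables (C : fieldType) (gT : finGroupType) (G H : {group gT}).
Variables (n : nat) (rH : mx_representation C H n).
Hypothesis sHG : H \subset G.
Local Notation N := #|ind_index G H n|.

(** The blocks of the matrix of g in the induced representation are the
zext (repr A * g * (repr B)^-1). *)
Definition zext (h : gT) : 'M[C]_n := if h \in H then rH h else 0.

Lemma zextM h g : h \in H -> zext (h * g)%g = rH h *m zext g.
Proof.
rewrite /zext => Hh; rewrite groupMl //; case: ifP => Hg; last by rewrite mulmx0.
by rewrite repr_mxM.
Qed.

(** The map f |-> f x on the space of the induced representation, in the
coordinates given by the values of f at the representatives of cosets. *)
Definition ind_eval (x : gT) : 'M[C]_(n, N) :=
  \matrix_(k, j) let: (A, l) := enum_val j in zext (x * (repr (val A))^-1)%g k l.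

(** Dual to [ind_eval]: the functions supported on the coset of x, parametrized by
their value at x. *)
Definition ind_bump (x : gT) : 'M[C]_(N, n) :=
  \matrix_(j, k) let: (A, l) := enum_val j in zext (repr (val A) * x^-1)%g l k.

(** Only the coset of x contributes, and an equivariant f is determined there by
its value at the representative. *)
Lemma sum_rcosets_zext m' (x : gT) (f : gT -> 'M[C]_(n, m')) :
  x \in G -> (forall h g, h \in H -> f (h * g)%g = rH h *m f g) ->
  \sum_(A : {A : {set gT} | A \in rcosets H G})
     zext (x * (repr (val A))^-1)%g *m f (repr (val A)) = f x.
Proof.
have rcosetE (A : {set gT}) : A \in rcosets H G -> A = H :* repr A.
  by case/rcosetsP=> y _ ->; rewrite rcoset_repr.
move=> Gx fH; have HA : H :* x \in rcosets H G by rewrite mem_rcosets mulSGid.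
pose A : {A : {set gT} | A \in rcosets H G} :=
  exist (fun A : {set gT} => A \in rcosets H G) _ HA.
have xA : (x * (repr (val A))^-1)%g \in H.
  by rewrite -mem_rcoset -rcosetE //= rcoset_refl.
rewrite (bigD1 A) //= big1 ?addr0 => [|D neDA].
  by rewrite /zext xA -fH // mulgKV.
rewrite /zext ifN ?mul0mx //; apply: contra neDA => xD.
by rewrite -val_eqE /= (rcosetE _ (valP D)); apply/eqP/esym/rcoset_eqP; rewrite mem_rcoset.
Qed.

Lemma sum_ind_index (V : nmodType) (f : ind_index G H n -> V) :
  \sum_(j < N) f (enum_val j) = \sum_A \sum_l f (A, l).
Proof.
rewrite pair_big /= (reindex (@enum_rank (ind_index G H n))) /=; last first.
  by apply: onW_bij; apply: enum_rank_bij.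
by apply: eq_bigr => -[A l] _; rewrite enum_rankK.
Qed.

(** The rows of M being the coordinates of f, applying [ind_eval x] recovers the
value at x. *)
Lemma ind_evalM m' x (f : gT -> 'M[C]_(n, m')) (M : 'M[C]_(N, m')) :
  x \in G -> (forall h g, h \in H -> f (h * g)%g = rH h *m f g) ->
  (forall j k, M j k = let: (A, l) := enum_val j in f (repr (val A)) l k) ->
  ind_eval x *m M = f x.
Proof.
move=> Gx fH defM; rewrite -(sum_rcosets_zext Gx fH).
apply/matrixP=> k l; rewrite !mxE summxE.
pose F (p : ind_index G H n) :=
  zext (x * (repr (val p.1))^-1)%g k p.2 * f (repr (val p.1)) p.2 l.
rewrite (eq_bigr (fun j => F (enum_val j))) => [|j _].
  by rewrite sum_ind_index; apply: eq_bigr => A _; rewrite mxE.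
by rewrite !mxE defM /F; case: (enum_val j).
Qed.

(** The value of g f at x is the value of f at x g. *)
Lemma ind_eval_act x g : x \in G -> ind_eval x *m ind_mx G rH g = ind_eval (x * g)%g.
Proof.
move=> Gx; pose f (y : gT) : 'M_(n, N) :=
  \matrix_(k, j) let: (A, l) := enum_val j in zext (y * g * (repr (val A))^-1)%g k l.
rewrite (ind_evalM (f := f) Gx).
- by apply/matrixP=> k j; rewrite !mxE; case: (enum_val j).
- move=> h y Hh; apply/matrixP=> k j; rewrite !mxE.
  case Dj: (enum_val j) => [A l]; rewrite -!mulgA zextM // mxE.
  by apply: eq_bigr => i _; rewrite !mxE Dj !mulgA.
move=> i j; rewrite !mxE; case: (enum_val i) => A k; rewrite mxE.
by case: (enum_val j) => D l; rewrite /zext; case: ifP => // _; rewrite mxE.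
Qed.

Lemma ind_eval_bump x y : x \in G -> ind_eval x *m ind_bump y = zext (x * y^-1)%g.
Proof.
move=> Gx; apply: (ind_evalM (f := fun z => zext (z * y^-1)%g)) => // [h g Hh|j k].
  by rewrite -mulgA zextM.
by rewrite mxE.
Qed.

Lemma ind_eval_left h x : h \in H -> ind_eval (h * x)%g = rH h *m ind_eval x.
Proof.
move=> Hh; apply/matrixP=> k j; rewrite !mxE; case Dj: (enum_val j) => [A l].
rewrite -mulgA zextM // mxE; apply: eq_bigr => i _.
by rewrite mxE Dj.
Qed.

Lemma card_ind_index : N = (#|G : H| * n)%N.
Proof. by rewrite card_prod card_ord card_sig. Qed.

(** The intertwiner is f |-> (f 1, f x): as x g = (x g x^-1) x, the group H acts
on the second component through the twist by x.  It has the functions supported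
on a single coset as a right inverse. *)
Lemma res_ind_index2 x (nHx : x \in 'N(H)) : #|G : H| = 2%N -> x \in G -> x \notin H ->
  mx_rsim (dadd_grepr (Representation rH) (Representation (twist_repr rH nHx)))
          (subg_repr (ind_repr rH sHG) sHG).
Proof.
move=> i2 Gx nHx'; exists (col_mx (ind_eval 1) (ind_eval x)).
- by rewrite card_ind_index i2 mul2n addnn.
- apply/row_freeP; exists (row_mx (ind_bump 1) (ind_bump x)).
  rewrite mul_col_row !ind_eval_bump // /zext invg1 !mulg1 mul1g mulgV groupV.
  by rewrite group1 (negPf nHx') repr_mx1 -scalar_mx_block.
move=> g Hg /=; rewrite mul_block_col !mul0mx addr0 add0r mul_col_mx.
have xg : (x * g = x * g * x^-1 * x)%g by rewrite mulgKV.
rewrite !ind_eval_act // mul1g.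
have -> : ind_eval g = rH g *m ind_eval 1 by rewrite -ind_eval_left // mulg1.
by rewrite {2}xg ind_eval_left ?memJV_norm.
Qed.
End InducedRestriction.

Lemma dadd_rsim (C : fieldType) (gT : finGroupType) (G : {group gT})
    n1 n2 m1 m2 (r1 : mx_representation C G n1) (r2 : mx_representation C G n2)
    (s1 : mx_representation C G m1) (s2 : mx_representation C G m2) :
  mx_rsim r1 s1 -> mx_rsim r2 s2 ->
  mx_rsim (dadd_grepr (Representation r1) (Representation r2))
          (dadd_grepr (Representation s1) (Representation s2)).
Proof.
move=> [f1 e1 /row_freeP[g1 fg1] h1] [f2 e2 /row_freeP[g2 fg2] h2].
exists (block_mx f1 0 0 f2); first by rewrite /= e1 e2.
- apply/row_freeP; exists (block_mx g1 0 0 g2).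
  by rewrite mulmx_block !(mulmx0, mul0mx, addr0, add0r) fg1 fg2 -scalar_mx_block.
move=> x Gx; rewrite /= !mulmx_block !(mulmx0, mul0mx, addr0, add0r).
by rewrite h1 // h2.
Qed.

Lemma dadd_rsimC (C : fieldType) (gT : finGroupType) (G : {group gT})
    n1 n2 (r1 : mx_representation C G n1) (r2 : mx_representation C G n2) :
  mx_rsim (dadd_grepr (Representation r1) (Representation r2))
          (dadd_grepr (Representation r2) (Representation r1)).
Proof.
exists (block_mx 0 1%:M 1%:M 0); first by rewrite /= addnC.
- apply/row_freeP; exists (block_mx 0 1%:M 1%:M 0).
  by rewrite mulmx_block !(mulmx0, mul0mx, addr0, add0r, mulmx1) -scalar_mx_block.
by move=> x Gx; rewrite /= !mulmx_block !(mulmx0, mul0mx, addr0, add0r, mulmx1, mul1mx).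
Qed.

(** * The symplectic group is generated by transvections *)

Section SymplecticPerms.
Variables (F : finFieldType) (m : nat) (W : symplSpace F m).
Local Notation W' := (finvect_type W).
Local Notation B := (sympl_form W).
Implicit Types (g h : {perm W'}) (u v w : W).

Lemma formC u v : B u v = - B v u.
Proof. by rewrite hermC expr1 mulN1r. Qed.

Lemma form_alt u : B u u = 0.
Proof.
have [_ _ alt] := sympl_axiom W; case char2: (2 \in [pchar F]); first exact: alt.
have nz2 : 2%:R != 0 :> F by move: char2; rewrite inE /= => ->.
apply/eqP; rewrite -(mulrI_eq0 _ (mulfI nz2)) mulr_natl mulr2n {2}formC.
by rewrite subrr.
Qed.

Lemma form_nondeg u : (forall v, B u v = 0) -> u = 0.
Proof.
move=> Bu0; have [/eqP nd _ _] := sympl_axiom W.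
by apply/eqP; rewrite -memv0 -nd; apply/mem_orthovP=> v _; apply: Bu0.
Qed.

Lemma linear_perm0 g : linear_perm g -> g 0 = 0 :> W.
Proof.
move=> /linear_permP/(_ 1 0 0); rewrite !scale1r addr0 => /eqP.
by rewrite -subr_eq0 opprD addrA subrr add0r oppr_eq0 => /eqP.
Qed.

Lemma linear_permD g u v : linear_perm g -> g (u + v) = (g u : W) + g v.
Proof. by move=> /linear_permP/(_ 1 u v); rewrite !scale1r. Qed.

Lemma linear_permZ g a u : linear_perm g -> g (a *: u) = a *: (g u : W).
Proof.
move=> Lg; have /linear_permP/(_ a u 0) := Lg.
by rewrite (linear_perm0 Lg) !addr0.
Qed.

Lemma linear_perm_sum g (I : finType) (f : I -> W) :
  linear_perm g -> g (\sum_i f i) = \sum_i (g (f i) : W).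
Proof.
move=> Lg; elim/big_rec2: _ => [|i y x _ <-]; first exact: linear_perm0.
by rewrite linear_permD.
Qed.

Lemma Sp_form g u v : g \in Sp W -> B (g u) (g v) = B u v.
Proof. by case/SpP=> _ /is_similitudeP[_ /(_ u v)->]; rewrite mul1r. Qed.

Lemma Sp_linear g : g \in Sp W -> linear_perm g. Proof. by case/SpP. Qed.

Definition transv_fun (c : F) v (w : W') : W' := (w : W) + (c * B w v) *: v.

Lemma transv_funK c v : cancel (transv_fun c v) (transv_fun (- c) v).
Proof.
move=> w; rewrite /transv_fun linearDl linearZl_LR /= form_alt mulr0 addr0.
by rewrite -[LHS]addrA -scalerDl mulNr subrr scale0r addr0.
Qed.

Definition transv c v : {perm W'} := perm (can_inj (transv_funK c v)).

Lemma transvE c v w : transv c v w = w + (c * B w v) *: v.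
Proof. by rewrite permE. Qed.

Lemma transv_Sp c v : transv c v \in Sp W.
Proof.
apply/SpP; split.
  apply/linear_permP=> a u w; rewrite !transvE linearDl linearZl_LR /=.
  rewrite scalerDr scalerA addrACA -scalerDl; congr (_ + _ *: _); ring.
apply/is_similitudeP; split=> [|u w]; first exact: oner_neq0.
rewrite !transvE !linearDl !linearDr /= !linearZl_LR !linearZr_LR /=.
by rewrite form_alt (formC v w) mul1r; ring.
Qed.

Lemma transvJ c v g : g \in Sp W -> (transv c v ^ g)%g = transv c (g v).
Proof.
move=> Sg; apply/permP=> w; rewrite -[w](permKV g) permJ !transvE Sp_form //.
by rewrite linear_permD ?Sp_linear // linear_permZ ?Sp_linear.
Qed.

Definition fixed_set g := [set w : W' | g w == w].

(** Induction on the number of vectors moved by g.  If <w, wg> != 0 for some w,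
the transvection along wg - w carrying wg back to w fixes all that g fixes, as
wg - w is orthogonal to the fixed vectors, and g followed by it fixes w as well.
If <w, wg> = 0 for all w, a transvection along some zg - z, which again keeps
the fixed vectors of g, leads back to the first case. *)
Lemma transv_generate (H : {group {perm W'}}) g :
  (forall c v, transv c v \in H) -> g \in Sp W -> g \in H.
Proof.
move=> HT; have [k] := ubnP #|~: fixed_set g|; elim: k g => // k IHk g ltk Sg.
have [g1|] := boolP [forall w, g w == w].
  suff -> : g = 1%g by apply: group1.
  by apply/permP=> w; rewrite perm1; apply/eqP/(forallP g1).
rewrite negb_forall => /existsP[w0 gw0].
have fixB h u w : h \in Sp W -> h u = u -> B u ((h w : W) - w) = 0.
  by move=> Sh hu; rewrite linearBr /= -{1}hu Sp_form // subrr.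
(* The first case, for any h which fixes at least what g fixes. *)
have step h w : h \in Sp W -> fixed_set g \subset fixed_set h -> B w (h w) != 0 -> h \in H.
  move=> Sh /subsetP sgh nz.
  rewrite -(groupMr _ (HT (- (B w (h w))^-1) ((h w : W) - w))).
  apply: IHk; last by rewrite groupM ?transv_Sp.
  apply: leq_trans (_ : #|~: fixed_set g| <= k)%N; last by rewrite -ltnS.
  apply: proper_card; rewrite properC; apply/properP; split.
    apply/subsetP=> u gu; have := sgh u gu; rewrite !inE permM => /eqP hu.
    by rewrite hu transvE fixB // mulr0 scale0r addr0.
  exists w; last first.
    apply: contraNN nz => /sgh; rewrite inE => /eqP->; rewrite form_alt eqxx //.
  rewrite inE permM transvE linearBr /= form_alt sub0r -formC mulNr.
  by rewrite mulVf // scaleN1r opprB addrC subrK.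
have [|] := boolP [exists w : W', B w (g w) != 0]; first by case/existsP=> w; apply: step.
rewrite negb_exists => /forallP alt0.
have alt u : B u (g u) = 0 by have := alt0 u; rewrite negbK => /eqP.
have skew u v : B u (g v) = B (g u) v.
  have := alt (u + v); rewrite linear_permD ?Sp_linear //.
  rewrite linearDl !linearDr /= !alt add0r addr0 => /eqP.
  by rewrite addr_eq0 => /eqP->; rewrite [RHS]formC.
(* The transvection along zg - z moves w0 g by a multiple of zg - z, which must
   be orthogonal neither to w0 nor to w0 g: both products are, up to sign,
   <w0 g - w0, z>. *)
have [z nz] : exists z : W', B ((g w0 : W) - w0) z != 0.
  apply/existsP; rewrite -negb_forall; apply: contra gw0 => /forallP Bz.
  by rewrite -subr_eq0; apply/eqP/form_nondeg=> z; apply/eqP/Bz.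
set v : W := (g z : W) - z.
have Sgt : (g * transv 1%R v)%g \in Sp W by rewrite groupM ?transv_Sp.
rewrite -(groupMr g (HT 1 v)); apply: (step _ w0 Sgt).
  apply/subsetP=> u; rewrite !inE permM => /eqP gu.
  by rewrite gu transvE fixB // mulr0 scale0r addr0.
rewrite permM transvE linearDr linearZr_LR /= alt add0r mul1r.
have -> : B w0 v = B ((g w0 : W) - w0) z by rewrite /v linearBr linearBl /= skew.
rewrite mulf_neq0 //; suff -> : B (g w0) v = B ((g w0 : W) - w0) z * -1.
  by rewrite mulrN1 oppr_eq0.
by rewrite /v linearBr linearBl /= Sp_form // mulrN1 opprB.
Qed.

End SymplecticPerms.

(** * Polarizations *)

Section Polarized.
Variables (F : finFieldType) (m : nat) (W : symplSpace F m) (P : polarization W).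
Local Notation W' := (finvect_type W).
Local Notation B := (sympl_form W).
Local Notation e := (pol_e P).
Local Notation es := (pol_es P).
Implicit Types (g h : {perm W'}) (u v w : W).

Lemma form_ese i j : B (es i) (e j) = - (j == i)%:R.
Proof. by rewrite formC pol_ees. Qed.

Lemma formXX u v : u \in polX P -> v \in polX P -> B u v = 0.
Proof.
move=> Xu Xv; suff /orthovP : (polX P <= orthov B (polX P))%VS by apply.
apply/span_subvP=> _ /codomP[i ->]; rewrite mem_orthov_sym.
by apply/span_subvP=> _ /codomP[j ->]; rewrite mem_orthov1 pol_ee.
Qed.

Lemma formXsXs u v : u \in polXs P -> v \in polXs P -> B u v = 0.
Proof.
move=> Xu Xv; suff /orthovP : (polXs P <= orthov B (polXs P))%VS by apply.
apply/span_subvP=> _ /codomP[i ->]; rewrite mem_orthov_sym.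
by apply/span_subvP=> _ /codomP[j ->]; rewrite mem_orthov1 pol_eses.
Qed.

Lemma mem_e i : e i \in polX P. Proof. exact/memv_span/codom_f. Qed.
Lemma mem_es i : es i \in polXs P. Proof. exact/memv_span/codom_f. Qed.

(** The linear map sending e i to x i and es i to y i: as <w, es i> and
- <w, e i> are the coordinates of w, this is a matrix in the symplectic basis. *)
Definition pol_map (x y : 'I_m -> W) w : W :=
  \sum_i (B w (es i) *: x i - B w (e i) *: y i).

Lemma pol_map_linear x y a u v :
  pol_map x y (a *: u + v) = a *: pol_map x y u + pol_map x y v.
Proof.
rewrite /pol_map scaler_sumr -big_split; apply: eq_bigr => i _ /=.
rewrite !linearDl !linearZl_LR /= !scalerDl scalerBr !scalerA opprD addrACA.
by [].
Qed.

Lemma pol_map_e x y i : pol_map x y (e i) = x i.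
Proof.
rewrite /pol_map (bigD1 i) //= big1 ?addr0 => [|j neji].
  by rewrite pol_ees pol_ee eqxx scale1r scale0r subr0.
by rewrite pol_ees pol_ee eq_sym (negPf neji) !scale0r subrr.
Qed.

Lemma pol_map_es x y i : pol_map x y (es i) = y i.
Proof.
rewrite /pol_map (bigD1 i) //= big1 ?addr0 => [|j neji].
  by rewrite form_ese pol_eses eqxx scale0r sub0r scaleNr opprK scale1r.
by rewrite form_ese pol_eses (negPf neji) oppr0 !scale0r subrr.
Qed.

Lemma pol_decomp w :
  exists x y, [/\ x \in polX P, y \in polXs P & w = x + y].
Proof.
have : w \in (polX P + polXs P)%VS by rewrite pol_full memvf.
by case/memv_addP=> x Xx [y Xsy ->]; exists x, y.
Qed.

Lemma linear_ext (f1 f2 : W -> W) :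
  (forall a u v, f1 (a *: u + v) = a *: f1 u + f1 v) ->
  (forall a u v, f2 (a *: u + v) = a *: f2 u + f2 v) ->
  (forall i, f1 (e i) = f2 (e i)) -> (forall i, f1 (es i) = f2 (es i)) -> f1 =1 f2.
Proof.
move=> L1 L2 fe fes.
have Z f (Lf : forall a u v, f (a *: u + v) = a *: f u + f v) : f 0 = 0 :> W.
  have := Lf 1 0 0; rewrite !scale1r addr0 => /eqP.
  by rewrite -subr_eq0 opprD addrA subrr add0r oppr_eq0 => /eqP.
have spanE (s : 'I_m -> W) w : (forall i, f1 (s i) = f2 (s i)) ->
    w \in <<codom s>>%VS -> f1 w = f2 w.
  move=> fs sw; rewrite (coord_span sw).
  elim/big_rec: _ => [|i x _ IH]; first by rewrite !Z.
  rewrite L1 L2 IH; congr (_ *: _ + _).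
  have /codomP[j ->] : (codom s)`_i \in codom s by rewrite mem_nth ?size_codom.
  exact: fs.
move=> w; have [x [y [Xx Xsy ->]]] := pol_decomp w.
by rewrite -[x]scale1r L1 L2 (spanE e) ?(spanE es).
Qed.

Lemma pol_mapE w : pol_map e es w = w.
Proof.
apply: (@linear_ext (pol_map e es) id) => // [|i|i].
- exact: pol_map_linear.
- exact: pol_map_e.
exact: pol_map_es.
Qed.

(** The sum is B u v: it depends neither on l nor on x and y, and for l = 1 and the
symplectic basis itself the map is the identity ([pol_mapE]). *)
Lemma form_pol_map l x y u v :
  (forall i j, B (x i) (x j) = 0) -> (forall i j, B (y i) (y j) = 0) ->
  (forall i j, B (x i) (y j) = l * (i == j)%:R) ->
  B (pol_map x y u) (pol_map x y v) =
  l * \sum_i (B u (e i) * B v (es i) - B u (es i) * B v (e i)).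
Proof.
move=> xx yy xy; rewrite linear_sumlz mulr_sumr; apply: eq_bigr => i _.
rewrite linear_sumr (bigD1 i) //= big1 ?addr0 => [|j neji].
  rewrite !(linearBl, linearBr) /= !(linearZl_LR, linearZr_LR) /= xx yy.
  by rewrite (formC (y i)) !xy eqxx /=; ring.
rewrite !(linearBl, linearBr) /= !(linearZl_LR, linearZr_LR) /= xx yy.
by rewrite (formC (y i)) !xy (negPf neji) eq_sym (negPf neji) /=; ring.
Qed.

Lemma pol_sim l x y : l != 0 ->
  (forall i j, B (x i) (x j) = 0) -> (forall i j, B (y i) (y j) = 0) ->
  (forall i j, B (x i) (y j) = l * (i == j)%:R) ->
  exists g, [/\ g \in GSp W, sim_factor g = l,
                forall i, g (e i) = x i & forall i, g (es i) = y i].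
Proof.
move=> nzl xx yy xy; pose f (w : W') : W' := pol_map x y w.
have fB u v : B (f u) (f v) = l * B u v.
  rewrite (@form_pol_map l) // -[in RHS](pol_mapE u) -[in RHS](pol_mapE v).
  by rewrite (@form_pol_map 1) ?mul1r // => *; rewrite ?pol_ee ?pol_eses ?pol_ees ?mul1r.
have f_inj : injective f.
  move=> u v Efuv; apply/eqP; rewrite -subr_eq0; apply/eqP/form_nondeg=> w.
  by apply: (mulfI nzl); rewrite mulr0 linearBl mulrBr -!fB Efuv subrr.
have Sg : is_similitude (perm f_inj) l.
  by apply/is_similitudeP; split=> // u v; rewrite !permE fB.
exists (perm f_inj); split=> [||i|i].
- apply/GSpP; split; last by exists l.
  by apply/linear_permP=> a u v; rewrite !permE; apply: pol_map_linear.
- exact: sim_factor_eq.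
- by rewrite permE; apply: pol_map_e.
by rewrite permE; apply: pol_map_es.
Qed.

Lemma GSp_linear g : g \in GSp W -> linear_perm g. Proof. by case/GSpP. Qed.

Lemma linear_perm_span g (s : 'I_m -> W) (U : {vspace W}) w : linear_perm g ->
  (forall i, (g (s i) : W) \in U) -> w \in <<codom s>>%VS -> (g w : W) \in U.
Proof.
move=> Lg gs sw; rewrite (coord_span sw) linear_perm_sum //; apply: rpred_sum => i _.
rewrite linear_permZ // rpredZ //.
by have /codomP[j ->] : (codom s)`_i \in codom s by rewrite mem_nth ?size_codom.
Qed.

Lemma linear_perm_spanZ g (s : 'I_m -> W) a w : linear_perm g ->
  (forall i, g (s i) = a *: s i) -> w \in <<codom s>>%VS -> g w = a *: w.
Proof.
move=> Lg gs sw; rewrite {1}(coord_span sw) linear_perm_sum //.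
rewrite {2}(coord_span sw) scaler_sumr; apply: eq_bigr => i _.
rewrite linear_permZ // scalerA mulrC -scalerA; congr (_ *: _).
by have /codomP[j ->] : (codom s)`_i \in codom s by rewrite mem_nth ?size_codom.
Qed.

Lemma dil_exists t : t != 0 ->
  exists d, [/\ d \in GSp W, sim_factor d = t,
    forall x, x \in polX P -> d x = x & forall y, y \in polXs P -> d y = t *: y].
Proof.
move=> nzt; have [||||d [Gd ld de des]] := @pol_sim t e (fun i => t *: es i) => //.
- exact: pol_ee.
- by move=> i j; rewrite linearZl_LR linearZr_LR /= pol_eses !mulr0.
- by move=> i j; rewrite linearZr_LR /= pol_ees.
exists d; split=> // [x Xx|y Xsy]; last exact: linear_perm_spanZ (GSp_linear Gd) _ Xsy.
rewrite -[RHS]scale1r; apply: linear_perm_spanZ (GSp_linear Gd) _ Xx => i.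
by rewrite scale1r.
Qed.

Lemma levi_exists t : t != 0 ->
  exists d, [/\ d \in Sp W,
    forall x, x \in polX P -> d x = t *: x & forall y, y \in polXs P -> d y = t^-1 *: y].
Proof.
move=> nzt.
have [||||d [Gd ld de des]] := @pol_sim 1 (fun i => t *: e i) (fun i => t^-1 *: es i).
- exact: oner_neq0.
- by move=> i j; rewrite linearZl_LR linearZr_LR /= pol_ee !mulr0.
- by move=> i j; rewrite linearZl_LR linearZr_LR /= pol_eses !mulr0.
- by move=> i j; rewrite linearZl_LR linearZr_LR /= pol_ees; field.
exists d; split=> [|x Xx|y Xsy].
- by apply/SpP; split; [exact: GSp_linear | rewrite -ld; exact: sim_factorP].
- exact: linear_perm_spanZ (GSp_linear Gd) _ Xx.
exact: linear_perm_spanZ (GSp_linear Gd) _ Xsy.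
Qed.

Lemma omega_exists :
  exists g, [/\ g \in Sp W, forall i, g (e i) = - es i & forall i, g (es i) = e i].
Proof.
have [||||d [Gd ld de des]] := @pol_sim 1 (fun i => - es i) e.
- exact: oner_neq0.
- by move=> i j; rewrite linearNl linearNr /= pol_eses !oppr0.
- exact: pol_ee.
- by move=> i j; rewrite linearNl /= form_ese opprK mul1r eq_sym.
by exists d; split=> //; apply/SpP; split; [exact: GSp_linear | rewrite -ld; exact: sim_factorP].
Qed.

(** It is enough to reach every transvection.  Those along X are the conjugates
by omega of those along X^*.  If <x, y> != 0, the transvection along y carrying
x + y to x conjugates the transvections along x + y to those along x.  If
<x, y> = 0 and x != 0, first add to y a vector of X^* not orthogonal to x, by a
transvection along it. *)
Lemma Sp_gen (H : {group {perm W'}}) g o :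
  (forall c v, v \in polXs P -> transv c v \in H) ->
  o \in Sp W -> (forall i, o (e i) = - es i) -> o \in H ->
  g \in Sp W -> g \in H.
Proof.
move=> HN So oe Ho; apply: transv_generate.
have conj h c v : h \in H -> h \in Sp W -> transv c (h v) \in H -> transv c v \in H.
  by move=> Hh Sh; rewrite -transvJ // memJ_norm // (subsetP (normG H)).
have HX c x : x \in polX P -> transv c x \in H.
  move=> Xx; apply: (conj o) => //; apply: HN.
  apply: linear_perm_span (Sp_linear So) _ Xx => i.
  by rewrite oe rpredN mem_es.
have gen c x y : x \in polX P -> y \in polXs P -> B x y != 0 -> transv c (x + y) \in H.
  move=> Xx Xsy nz; apply: (conj (transv (- (B x y)^-1) y));
    [exact: HN | exact: transv_Sp |].
  rewrite transvE linearDl /= form_alt addr0 mulNr mulVf // scaleN1r addrK.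
  exact: HX.
move=> c v; have [x [y [Xx Xsy ->]]] := pol_decomp v.
have [->|nzx] := eqVneq x 0; first by rewrite add0r HN.
have [Bxy0|nz] := eqVneq (B x y) 0; last exact: gen.
have [i nzi] : exists i, B x (es i) != 0.
  apply/existsP; rewrite -negb_forall; apply: contra nzx => /forallP Bx.
  apply/eqP; rewrite -[x]pol_mapE /pol_map big1 // => i _.
  by rewrite (eqP (Bx i)) (formXX Xx (mem_e i)) !scale0r subrr.
apply: (conj (transv 1 (es i))); [exact/HN/mem_es | exact: transv_Sp |].
rewrite transvE linearDl /= (formXsXs Xsy (mem_es i)) addr0 mul1r -addrA.
apply: gen => //; first by rewrite rpredD // rpredZ // mem_es.
by rewrite linearDr linearZr_LR /= Bxy0 add0r mulf_neq0.
Qed.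

End Polarized.

(** * The projective cover and its quotient by Sp(W) *)

Lemma coverData_two_neq0 (F : finFieldType) (c : coverData F) : 2 != 0 :> F.
Proof. by apply: contra (neg1_neq1 c) => two0; rewrite eq_sym -addr_eq0. Qed.

Lemma is_squareV (F : finFieldType) (b : F) : is_square b^-1 = is_square b.
Proof.
by apply/is_squareP/is_squareP => -[s Ds]; exists s^-1; rewrite exprVn -Ds ?invrK.
Qed.

Lemma index2_intro (gT : finGroupType) (G H : {group gT}) x :
  H \subset G -> x \in G -> x \notin H ->
  (forall y z, y \in G -> z \in G -> y \notin H -> z \notin H -> (y * z^-1)%g \in H) ->
  #|G : H| = 2%N.
Proof.
move=> sHG Gx nHx H2; rewrite /indexg; have -> : rcosets H G = [set (H : {set gT}); H :* x].
  apply/setP=> A; rewrite !inE; apply/rcosetsP/orP => [[y Gy ->]|[/eqP->|/eqP->]].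
  - have [Hy|nHy] := boolP (y \in H); [left | right].
      by rewrite rcoset_id.
    by apply/eqP/rcoset_eqP; rewrite mem_rcoset H2.
  - by exists 1%g; rewrite ?group1 // mulg1.
  by exists x.
rewrite cards2; case: eqP => // EH.
by case/negP: nHx; rewrite EH rcoset_refl.
Qed.

Section ProjectiveCover.
Variables (F : finFieldType) (c : coverData F) (m : nat) (W : symplSpace F m).
Local Notation G := (GSp W).
Local Notation la := (@sim_factor F m W).
Local Notation tG := (Defs_tGSp__canonical__fingroup_FinGroup c W).
Local Notation tval := (@Defs.tval F m W).
Implicit Types (x y : tG).

Lemma sim_factorV (g : {perm finvect_type W}) : g \in G -> la g^-1 = (la g)^-1.
Proof.
move=> Gg; apply: (mulfI (sim_factor_neq0 Gg)).
by rewrite -sim_factorM ?groupV // mulgV sim_factor_Sp ?group1 // mulfV ?sim_factor_neq0.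
Qed.

Lemma sim_factor1_Sp (g : {perm finvect_type W}) : g \in G -> la g = 1 -> g \in Sp W.
Proof.
move=> Gg lg; apply/SpP; split; first by case/GSpP: Gg.
by rewrite -lg; apply: sim_factorP.
Qed.

Lemma GSp_norm_Sp (g : {perm finvect_type W}) : g \in G -> g \in 'N(Sp W).
Proof.
move=> Gg; rewrite inE; apply/subsetP=> _ /imsetP[h Sh ->].
have Gh := subsetP (Sp_sub_GSp W) h Sh.
apply: sim_factor1_Sp; first by rewrite groupJ.
rewrite conjgE !sim_factorM ?groupM ?groupV // sim_factorV // (sim_factor_Sp Sh).
by rewrite mul1r mulVf ?sim_factor_neq0.
Qed.

Lemma GSp_square_decomp (g : {perm finvect_type W}) s :
  g \in G -> s != 0 -> la g = s ^+ 2 ->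
  exists2 h, h \in Sp W & g = (scal_perm W s * h)%g.
Proof.
move=> Gg nzs lg; exists ((scal_perm W s)^-1 * g)%g; last by rewrite mulKVg.
have Gs := scal_perm_GSp W nzs; apply: sim_factor1_Sp; first by rewrite groupM ?groupV.
rewrite sim_factorM ?groupV // sim_factorV // lg (sim_factor_eq (scal_perm_sim W nzs)).
by rewrite mulVf ?expf_neq0.
Qed.

(** An element [g, e] whose factor is a square a is nu [a, e] times an element of
Sp(W).  In this product the second factor has similitude factor 1, so the cocycle
contributes no sign. *)
Lemma mem_Sp_emb x :
  (coset (nu_group c W) x \in Sp_emb c W @* Sp W) = is_square (la (tval x)).
Proof.
have laE y z : coset (nu_group c W) y = coset (nu_group c W) z ->
    is_square (la (tval y)) = is_square (la (tval z)).
  move=> Eyz; have : y \in (nu_group c W :* z)%g.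
    by rewrite -val_coset ?norm_nu // -Eyz val_coset ?norm_nu // rcoset_refl.
  case/rcosetP=> _ /imsetP[[a e] /setXP[/= sa _] ->] ->.
  rewrite tval_mul sim_factorM ?tval_GSp // la_nu //.
  by move: sa; rewrite inE => /andP[nza sa]; rewrite is_squareM // (negPf nza).
apply/morphimP/idP => [[g _ Sg]|sx].
  move/laE->; rewrite tval_mk ?(subsetP (Sp_sub_GSp W)) // sim_factor_Sp //.
  exact: is_square1.
have sa : la (tval x) \in nz_squares F by rewrite inE la_neq0.
have nzs := nu_scal_neq0 c (tsgn x) sa.
have la_s : la (tval x) = (cv_sqrt c (la (tval x)) * (-1) ^+ tsgn x) ^+ 2.
  by rewrite exprMn sqrt_sq ?la_neq0 // sqrr_sign mulr1.
have [h Sh Dx] := GSp_square_decomp (tval_GSp x) nzs la_s.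
have Gh := subsetP (Sp_sub_GSp W) h Sh.
exists h => //; rewrite /Sp_emb -[RHS]mul1g.
have -> : 1%g = coset (nu_group c W) (nu c W (la (tval x), tsgn x)).
  by apply/esym/coset_id; apply: imset_f; rewrite inE sa inE.
rewrite -morphM ?norm_nu //; congr (coset _ _); apply: tGSp_eqP.
  by rewrite tval_mul tval_nu // tval_mk.
rewrite tsgn_mk la_nu // !tsgn_mk tval_mk // (sim_factor_Sp Sh).
by rewrite c'''C c'''1 addbF.
Qed.

(** The cocycle is symmetric, so conjugation in the cover does not affect
signs. *)
Lemma Sp_embJ (d g : {perm finvect_type W}) : d \in G -> g \in Sp W ->
  (coset (nu_group c W) (tGSp_mk d false) * Sp_emb c W g =
   Sp_emb c W (d * g * d^-1) * coset (nu_group c W) (tGSp_mk d false))%g.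
Proof.
move=> Gd Sg; have Gg := subsetP (Sp_sub_GSp W) g Sg.
have Gdg : (d * g * d^-1)%g \in G by rewrite !groupM ?groupV.
have Sdg : (d * g * d^-1)%g \in Sp W.
  apply: sim_factor1_Sp; rewrite // !sim_factorM ?groupM ?groupV // sim_factorV //.
  by rewrite (sim_factor_Sp Sg) mulr1 mulfV ?sim_factor_neq0.
have cosetM x y : coset (nu_group c W) (tGSp_mul c x y) =
    (coset (nu_group c W) x * coset (nu_group c W) y)%g.
  exact: (morphM (coset_morphism (nu_group c W)) (norm_nu c x) (norm_nu c y)).
have mkJ : tGSp_mul c (tGSp_mk d false) (tGSp_mk g false) =
    tGSp_mul c (tGSp_mk (d * g * d^-1)%g false) (tGSp_mk d false).
  apply: tGSp_eqP; first by rewrite !tval_mul !tval_mk // mulgKV.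
  by rewrite !tsgn_mk !tval_mk // (sim_factor_Sp Sg) (sim_factor_Sp Sdg) c'''C.
by rewrite /Sp_emb -!cosetM mkJ.
Qed.

Lemma squares_group_set : group_set [set (u ^+ 2)%g | u : {unit F}].
Proof.
apply/group_setP; split=> [|_ _ /imsetP[u _ ->] /imsetP[v _ ->]].
  by apply/imsetP; exists 1%g; rewrite ?inE ?expg1n.
apply/imsetP; exists (u * v)%g; rewrite ?inE // expgMn //.
by apply: val_inj; rewrite /= mulrC.
Qed.
Definition unit_squares := Group squares_group_set.

Lemma mem_unit_squares (u : {unit F}) : (u \in unit_squares) = is_square (val u).
Proof.
apply/imsetP/is_squareP => [[v _ ->]|[b Db]].
  by exists (val v); rewrite FinRing.val_unitX.
have ub : b \is a GRing.unit by rewrite unitfE -sqrf_eq0 -Db -unitfE (valP u).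
by exists (FinRing.unit F ub); rewrite ?inE //; apply: val_inj; rewrite FinRing.val_unitX.
Qed.

Lemma la_unit x : la (tval x) \is a GRing.unit.
Proof. by rewrite unitfE la_neq0. Qed.

(** The similitude factor in F^x / F^x2, whose kernel is the product of the
central subgroup nu and Sp(W). *)
Definition sim_class x : coset_of unit_squares :=
  coset unit_squares (FinRing.unit F (la_unit x)).

Lemma norm_unit_squares (u : {unit F}) : u \in 'N(unit_squares).
Proof.
apply/normP; apply/setP=> v; rewrite mem_conjg.
suff -> : (v ^ u^-1)%g = v by [].
by apply: val_inj; rewrite conjgE invgK /= mulrC mulrVK ?(valP u).
Qed.

Lemma sim_classM : {in [set: tG] &, {morph sim_class : x y / (x * y)%g}}.
Proof.
move=> x y _ _; rewrite /sim_class -morphM ?norm_unit_squares //; congr (coset _ _).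
by apply: val_inj; rewrite /= tval_mul sim_factorM ?tval_GSp.
Qed.
Canonical sim_class_morphism := Morphism sim_classM.

Lemma mem_ker_sim_class x : (x \in 'ker sim_class) = is_square (la (tval x)).
Proof.
rewrite !inE /= -(mem_unit_squares (FinRing.unit F (la_unit x))).
by apply/eqP/idP => [/(coset_idr (norm_unit_squares _))|/coset_id].
Qed.

Lemma nu_sub_ker : nu_set c W \subset 'ker sim_class.
Proof.
apply/subsetP=> _ /imsetP[[a e] /setXP[/= sa _] ->].
by rewrite mem_ker_sim_class la_nu //; move: sa; rewrite inE => /andP[].
Qed.

Lemma Sp_emb_im : Sp_emb c W @* Sp W = ('ker sim_class / nu_group c W)%g.
Proof.
apply/setP=> X; have [x _ ->] := cosetP X; rewrite mem_Sp_emb -mem_ker_sim_class.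
apply/idP/idP => [Kx|/morphimP[y _ Ky Exy]]; first exact: mem_quotient.
rewrite mem_ker_sim_class -mem_Sp_emb Exy mem_Sp_emb.
by rewrite -mem_ker_sim_class.
Qed.

Lemma Sp_emb_normal : Sp_emb c W @* Sp W <| PGSp c W.
Proof. by rewrite Sp_emb_im; apply/quotient_normal/ker_normal. Qed.
End ProjectiveCover.
Arguments sim_class {F} c {m} W x.

Section Quotient.
Variables (F : finFieldType) (c : coverData F) (m : nat) (W : symplSpace F m).
Variable (P : polarization W).

Lemma sim_class_im : sim_class c W @* setT = ([set: {unit F}] / unit_squares F)%g.
Proof.
apply/setP=> X; have [u _ ->] := cosetP X; rewrite mem_quotient ?inE //.
have nzu : val u != 0 by rewrite -unitfE (valP u).
have [d [Gd ld _ _]] := dil_exists P nzu.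
apply/morphimP; exists (tGSp_mk d false); rewrite ?inE //.
congr (coset _ _); apply: val_inj; by rewrite /= tval_mk.
Qed.

Lemma PGSp_quotient_isog :
  (PGSp c W / (Sp_emb c W @* Sp W)) \isog ([set: {unit F}] / unit_squares F).
Proof.
rewrite Sp_emb_im -sim_class_im.
apply: isog_trans (first_isog _).
apply: third_isog (nu_sub_ker _ _) _ (ker_normal _).
by rewrite /normal subsetT; apply/subsetP=> x _; apply: norm_nu.
Qed.

Lemma PGSp_index2 : #|PGSp c W : Sp_emb c W @* Sp W| = 2%N.
Proof.
have [d [Gd ld _ _]] := dil_exists P (xi_neq0 c).
apply: (@index2_intro _ _ _ (coset (nu_group c W) (tGSp_mk d false))).
- exact: Sp_emb_sub.
- by apply: mem_quotient; rewrite inE.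
- by rewrite mem_Sp_emb tval_mk // ld xi_nsq.
move=> X Y _ _; have [x _ ->] := cosetP X; have [y _ ->] := cosetP Y.
rewrite -morphV ?norm_nu // -morphM ?norm_nu // !mem_Sp_emb.
have -> : Defs.tval (x * y^-1)%g = (Defs.tval x * (Defs.tval y)^-1)%g.
  by rewrite tval_mul; congr (_ * _)%g; apply: tval_mk; rewrite groupV tval_GSp.
rewrite sim_factorM ?groupV ?tval_GSp // sim_factorV ?tval_GSp // => nsx nsy.
by apply: nonsqM; rewrite ?is_squareV; apply: negPf.
Qed.
End Quotient.

(** * The restriction of rho *)

Section RhoRestriction.
Variables (F : finFieldType) (c : coverData F) (m : nat) (W : symplSpace F m).
Variable (P : polarization W).
Variables (C : fieldType) (n : nat).
Local Notation W' := (finvect_type W).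
Local Notation repr := (mx_representation C (Sp W) n).
Implicit Types (g d : {perm W'}) (r : repr).

(** If the factor of d is s^2, then d is the product of the central homothety of
ratio s and an element of Sp(W), so the twist is by an inner automorphism. *)
Lemma twist_square_rsim r d (Nd : d \in 'N(Sp W)) :
  d \in GSp W -> is_square (sim_factor d) -> mx_rsim (twist_repr r Nd) r.
Proof.
move=> Gd /is_squareP[s ld].
have nzs : s != 0 by rewrite -sqrf_eq0 -ld sim_factor_neq0.
have [h Sh Dd] := GSp_square_decomp Gd nzs ld.
have Nh : h \in 'N(Sp W) by rewrite (subsetP (normG _)).
apply: mx_rsim_trans (twist_rsim r Nh Sh).
exists 1%:M => [//||g Sg]; first by rewrite row_free_unit unitmx1.
have Gg : g \in GSp W by rewrite (subsetP (Sp_sub_GSp W)).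
have Gh : h \in GSp W by rewrite (subsetP (Sp_sub_GSp W)).
have sC := scal_permC nzs (groupM (groupM Gh Gg) (groupVr Gh)).
rewrite mul1mx mulmx1 /= Dd; congr (r _); rewrite -[RHS](mulgK (scal_perm W s)) -sC.
by rewrite invMg !mulgA.
Qed.

Lemma twist_rsim_congr r r' d (Nd : d \in 'N(Sp W)) :
  mx_rsim r r' -> mx_rsim (twist_repr r Nd) (twist_repr r' Nd).
Proof.
by case=> f en fr fJ; exists f => // g Sg /=; apply: fJ; apply: memJV_norm.
Qed.

Lemma twist_twist_rsim r d (Nd : d \in 'N(Sp W)) (Ndd : (d * d)%g \in 'N(Sp W)) :
  mx_rsim (twist_repr (twist_repr r Nd) Nd) (twist_repr r Ndd).
Proof.
exists 1%:M => [//||g Sg]; first by rewrite row_free_unit unitmx1.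
by rewrite mul1mx mulmx1 /= invMg !mulgA.
Qed.

(** The class of [d, 1] lies outside Sp(W) and acts on it as d does. *)
Lemma rho_Sp_rsim r d (Nd : d \in 'N(Sp W)) :
  d \in GSp W -> ~~ is_square (sim_factor d) ->
  mx_rsim (rho_Sp c r) (dadd_grepr (Representation r) (Representation (twist_repr r Nd))).
Proof.
move=> Gd nsd; set H := (Sp_emb c W @* Sp W)%G.
pose x := coset (nu_group c W) (tGSp_mk d false).
have Nx : x \in 'N(H).
  have /andP[_ /subsetP nH] := Sp_emb_normal c W.
  by apply: nH; apply: mem_quotient; rewrite inE.
have Gx : x \in PGSp c W by apply: mem_quotient; rewrite inE.
have nHx : x \notin H by rewrite mem_Sp_emb tval_mk.
have [f en fr fJ] := res_ind_index2 (transport_repr (Sp_emb_inj c W) r)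
  (Sp_emb_sub c W) Nx (PGSp_index2 c P) Gx nHx.
apply: mx_rsim_sym; exists f => // g Sg.
have Hg : Sp_emb c W g \in H by apply: mem_morphim.
transitivity (f *m subg_repr (ind_repr (transport_repr (Sp_emb_inj c W) r)
  (Sp_emb_sub c W)) (Sp_emb_sub c W) (Sp_emb c W g)); last by [].
rewrite -fJ //; congr (_ *m f); rewrite /= invmE //.
rewrite [(x * _)%g](Sp_embJ c Gd Sg) mulgK.
by rewrite invmE // (memJV_norm Nd Sg).
Qed.

Lemma rho_Sp_congr r r' :
  mx_rsim r r' -> mx_rsim (rho_Sp c r) (rho_Sp c r').
Proof.
move=> Epi; have [d [Gd ld _ _]] := dil_exists P (xi_neq0 c).
have Nd := GSp_norm_Sp Gd.
have nsd : ~~ is_square (sim_factor d) by rewrite ld xi_nsq.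
apply: mx_rsim_trans (rho_Sp_rsim r Nd Gd nsd) _.
apply: mx_rsim_trans _ (mx_rsim_sym (rho_Sp_rsim r' Nd Gd nsd)).
by apply: dadd_rsim => //; apply: twist_rsim_congr.
Qed.

(** Twisting by d exchanges the two summands, the twist by d^2 being trivial up
to isomorphism. *)
Lemma rho_Sp_twist r d (Nd : d \in 'N(Sp W)) :
  d \in GSp W -> mx_rsim (rho_Sp c (twist_repr r Nd)) (rho_Sp c r).
Proof.
move=> Gd; have [sd|nsd] := boolP (is_square (sim_factor d)).
  by apply: rho_Sp_congr; apply: twist_square_rsim.
have Ndd : (d * d)%g \in 'N(Sp W) by rewrite groupM.
apply: mx_rsim_trans (rho_Sp_rsim _ Nd Gd nsd) _.
apply: mx_rsim_trans _ (mx_rsim_sym (rho_Sp_rsim r Nd Gd nsd)).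
apply: mx_rsim_trans _ (dadd_rsimC _ _); apply: dadd_rsim.
  exact: mx_rsim_refl.
apply: mx_rsim_trans (twist_twist_rsim r Nd Ndd) _.
apply: twist_square_rsim; first by rewrite groupM.
by apply/is_squareP; exists (sim_factor d); rewrite sim_factorM.
Qed.

End RhoRestriction.

(** * Characters and Gauss sums *)

Section GaussSums.
Variables (F : finFieldType) (C : fieldType).
Implicit Types (psi : F -> C) (a b s t x y : F).

Lemma char_scale_nontrivial psi a :
  a != 0 -> nontrivial_char psi -> nontrivial_char (char_scale psi a).
Proof.
move=> nza [psi0 psiD [t psit]]; rewrite /char_scale; split=> [|s u|].
- by rewrite mulr0.
- by rewrite mulrDr psiD.
by exists (a^-1 * t); rewrite mulVKf.
Qed.

Lemma sum_char psi : nontrivial_char psi -> \sum_t psi t = 0.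
Proof.
case=> psi0 psiD [t psit]; apply/eqP.
have : (psi t - 1) * \sum_u psi u == 0.
  rewrite mulrBl mul1r mulr_sumr subr_eq0 [X in _ == X](reindex_inj (addrI t)) /=.
  by apply/eqP/eq_bigr => u _; rewrite psiD.
by rewrite mulf_eq0 subr_eq0 (negPf psit).
Qed.

(** Otherwise psi' times the inverse of psi^b would be nontrivial for every b, so
the sum of its values would vanish; but the sum over b of these sums is the
cardinality of F, by orthogonality in the other variable. *)
Lemma char_dual psi psi' : #|F|%:R != 0 :> C ->
  nontrivial_char psi -> nontrivial_char psi' ->
  exists2 b, b != 0 & psi' =1 char_scale psi b.
Proof.
move=> nzq npsi [psi'0 psi'D npsi']; have [psi0 psiD _] := npsi.
have psiV t : psi t * psi (- t) = 1 by rewrite -psiD subrr.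
have [/existsP[b /forallP/(_ _)/eqP Db]|nodual] :=
    boolP [exists b, forall t, psi' t == psi (b * t)].
  exists b => //; case: npsi' => t; apply: contraNneq => b0.
  by rewrite Db b0 mul0r psi0.
case/eqP: nzq; transitivity (\sum_b \sum_t psi' t * psi (- b * t)); last first.
  apply: big1 => b _; apply: sum_char; split; first by rewrite psi'0 mulr0 psi0 mulr1.
    by move=> s t; rewrite mulrDr psiD psi'D mulrACA.
  have /existsP[t nt] : [exists t, psi' t != psi (b * t)].
    by rewrite -negb_forall; apply: contra nodual => ?; apply/existsP; exists b.
  exists t; apply: contra nt => /eqP Et.
  by rewrite -[psi' t]mulr1 -(psiV (b * t)) mulrCA -mulNr Et mulr1.
rewrite exchange_big (bigD1 0) //= [X in _ + X]big1 ?addr0 => [|t nzt].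
  rewrite psi'0 (eq_bigr (fun=> 1)) => [|b _]; last by rewrite mulr0 psi0 mulr1.
  by rewrite sumr_const cardT.
rewrite -mulr_sumr (eq_bigr (char_scale psi (- t))) => [|b _]; last first.
  by rewrite /char_scale mulrC mulrN mulNr [t * b]mulrC.
by rewrite sum_char ?mulr0 //; apply: char_scale_nontrivial; rewrite ?oppr_eq0.
Qed.

Lemma legendreX b m : legendre C (b ^+ m) = legendre C b ^+ m :> C.
Proof.
elim: m => [|m IHm]; first by rewrite !expr0 /legendre oner_eq0 is_square1.
rewrite !exprS -IHm /legendre mulf_eq0.
have [//|nzb] := eqVneq b 0; first by rewrite mul0r.
have [|nzbm] /= := eqVneq; first by rewrite mulr0.
case sb: (is_square b); first by rewrite is_squareM // (negPf nzb) mul1r.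
case sbm: (is_square (b ^+ m)); first by rewrite [b * _]mulrC is_squareM // (negPf nzbm) sb mulr1.
by rewrite nonsqM // mulrNN mulr1.
Qed.

Hypothesis two_neq0 : 2 != 0 :> F.

Lemma card_sqrt t :
  #|[pred x : F | x ^+ 2 == t]| = (if t == 0%R then 1 else if is_square t then 2 else 0)%N.
Proof.
have [->|nzt] := eqVneq.
  by rewrite -(card1 (0 : F)); apply: eq_card => x; rewrite !inE expf_eq0.
case: ifP => [/is_squareP[s Ds]|nst]; last first.
  apply: eq_card0 => x; rewrite inE; apply: contraFF nst => /eqP <-.
  by apply/is_squareP; exists x.
have nzs : s != 0 by apply: contraNneq nzt => s0; rewrite Ds s0 expr0n.
transitivity #|pred2 s (- s)|.
  by apply: eq_card => x; rewrite !inE Ds eqf_sqr.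
by rewrite card2 -addr_eq0 -mulr2n -mulr_natl mulf_neq0.
Qed.

(** Each t != 0 is hit exactly twice by exactly one of x^2 and b x^2, and 0 is
hit once by each. *)
Lemma sum_squares (f : F -> C) b : ~~ is_square b ->
  \sum_x f (x ^+ 2) + \sum_x f (b * x ^+ 2) = 2 * \sum_t f t.
Proof.
move=> nsb; have nzb : b != 0.
  by apply: contraNneq nsb => ->; apply/is_squareP; exists 0; rewrite expr0n.
have count (h : F -> F) :
    \sum_x f (h x) = \sum_t #|[pred x | h x == t]|%:R * f t.
  rewrite (partition_big h predT) //=; apply: eq_bigr => t _.
  by rewrite (eq_bigr (fun=> f t)) => [|x /eqP-> //]; rewrite sumr_const mulr_natl.
rewrite (count (fun x => x ^+ 2)) (count (fun x => b * x ^+ 2)).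
rewrite -big_split mulr_sumr; apply: eq_bigr => t _ /=.
rewrite -mulrDl -natrD card_sqrt; congr (_%:R * _).
have -> : #|[pred x | b * x ^+ 2 == t]| = #|[pred x | x ^+ 2 == t / b]|.
  apply: eq_card => x; rewrite !inE; apply/eqP/eqP => [<-|->].
    by rewrite mulrAC mulfV // mul1r.
  by rewrite mulrCA mulfV ?mulr1.
rewrite card_sqrt mulf_eq0 invr_eq0 (negPf nzb) orbF; have [//|nzt] := eqVneq t 0.
case st: (is_square t); first by rewrite is_squareM // (negPf nzt) is_squareV (negPf nsb).
by rewrite nonsqM // is_squareV; apply: negPf.
Qed.

Lemma gauss_sum_scale psi b : nontrivial_char psi -> b != 0 ->
  gauss_sum (char_scale psi b) = legendre C b * gauss_sum psi.
Proof.
move=> npsi nzb; rewrite /legendre (negPf nzb); case: ifPn => [/is_squareP[s Ds]|nsb].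
  have nzs : s != 0 by apply: contraNneq nzb => s0; rewrite Ds s0 expr0n.
  rewrite mul1r [RHS](reindex_inj (mulfI nzs)); apply: eq_bigr => x _.
  by rewrite /char_scale Ds exprMn mulrA.
have := sum_squares (fun t => psi (t / 2)) nsb.
have -> : \sum_t psi (t / 2) = 0.
  rewrite (eq_bigr (char_scale psi 2^-1)) => [|t _]; last by rewrite /char_scale mulrC.
  by apply: sum_char; apply: char_scale_nontrivial; rewrite ?invr_eq0.
rewrite mulr0 addrC => /eqP; rewrite addr_eq0 mulN1r => /eqP <-.
by apply: eq_bigr => x _; rewrite /char_scale mulrA.
Qed.

(** With x = y + u the phase (x^2 - y^2) / 2 becomes u^2 / 2 + u y, and the sum over
y vanishes unless u = 0. *)
Lemma gauss_sumM psi : nontrivial_char psi ->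
  gauss_sum psi * gauss_sum (char_scale psi (-1)) = #|F|%:R.
Proof.
move=> npsi; have [psi0 psiD _] := npsi.
rewrite mulr_suml.
transitivity (\sum_(u : F) \sum_(y : F) psi (u ^+ 2 / 2) * char_scale psi u y).
  under eq_bigr do rewrite mulr_sumr.
  rewrite exchange_big [RHS]exchange_big /=; apply: eq_bigr => y _.
  rewrite (reindex_inj (addrI y)) /=; apply: eq_bigr => u _.
  rewrite /char_scale -!psiD; congr psi; by field.
rewrite (bigD1 0) //= [X in _ + X]big1 ?addr0 => [|u nzu].
  rewrite (eq_bigr (fun=> 1)) => [|y _]; last first.
    by rewrite /char_scale expr0n !mul0r psi0 mulr1.
  by rewrite sumr_const.
by rewrite -mulr_sumr sum_char ?mulr0 //; apply: char_scale_nontrivial.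
Qed.
End GaussSums.

(** * Weil representations *)

Section WeilUniqueness.
Variables (F : finFieldType) (m : nat) (W : symplSpace F m) (P : polarization W).
Variable C : fieldType.
Local Notation W' := (finvect_type W).
Local Notation B := (sympl_form W).
Local Notation e := (pol_e P).
Local Notation es := (pol_es P).
Local Notation N := #|setX_pol P|.
Hypothesis two_neq0 : 2 != 0 :> F.
Implicit Types (g d : {perm W'}) (u v w : W) (psi : F -> C).

Lemma CX_inj (M1 M2 : 'M[C]_N) :
  (forall f, M1 *m CX P f = M2 *m CX P f) -> M1 = M2.
Proof.
move=> eqM; apply/matrixP=> k j.
suff /colP/(_ k) : col j M1 = col j M2 by rewrite !mxE.
rewrite !colE.
have -> : delta_mx j 0 = CX P (fun w : W => ((w : W') == enum_val j)%:R) :> 'cV[C]_N.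
  by apply/colP=> i; rewrite !mxE andbT (inj_eq enum_val_inj).
exact: eqM.
Qed.

Lemma eq_CX (f1 f2 : W -> C) : {in polX P, f1 =1 f2} -> CX P f1 = CX P f2.
Proof.
move=> eqf; apply/colP=> i; rewrite !mxE; apply: eqf.
by have := enum_valP i; rewrite inE.
Qed.

Lemma weil_transv psi (pi : mx_representation C (Sp W) N) a v (f : W -> C) :
  weil_formulas psi pi -> v \in polXs P ->
  pi (transv a v) *m CX P f = CX P (fun y => psi (2^-1 * (a * B y v ^+ 2)) * f y).
Proof.
move=> [piN _ _] Xsv.
rewrite (piN _ (fun w => (a * B w v) *: v)) ?transv_Sp //.
- by apply: eq_CX => y _; rewrite linearZr_LR /= expr2 !mulrA.
- by move=> x _; rewrite transvE rpredZ.
by move=> x Xsx; rewrite transvE (formXsXs Xsx Xsv) mulr0 scale0r addr0.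
Qed.

(** Take d fixing X pointwise and dividing by b on X^*.  The elements g of Sp(W) at
which pi' and the twist agree form a subgroup, and [Sp_gen] reduces the claim to
two computations.  A transvection along v in X^* sends y in X to y + a <y, v> v,
and conjugating it by d multiplies a by b.  And d omega d^-1 = l omega, where l is b on X and
1/b on X^*, so that det l = b^m; the Legendre symbol of b^m is the ratio of the
m-th powers of the Gauss sums. *)
Lemma weil_twist psi psi' b (pi pi' : mx_representation C (Sp W) N) :
  nontrivial_char psi -> b != 0 -> psi' =1 char_scale psi b ->
  weil_formulas psi pi -> weil_formulas psi' pi' ->
  exists d (Nd : d \in 'N(Sp W)),
    [/\ d \in GSp W, sim_factor d = b^-1 & mx_rsim pi' (twist_repr pi Nd)].
Proof.
move=> npsi nzb Epsi piW piW'.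
have nzbV : b^-1 != 0 by rewrite invr_eq0.
have [d [Gd ld dX dXs]] := dil_exists P nzbV.
have Nd := GSp_norm_Sp Gd; exists d, Nd; split=> //.
have dV u : d^-1%g (d u) = u by rewrite permK.
have dVX x : x \in polX P -> d^-1%g x = x by move=> Xx; rewrite -[RHS]dV dX.
have dVXs y : y \in polXs P -> d^-1%g y = b *: y.
  by move=> Xsy; rewrite -[RHS]dV dXs ?rpredZ // scalerK.
suff eq_pi g : g \in Sp W -> pi' g = pi (d * g * d^-1)%g.
  exists 1%:M => [//||g Sg]; first by rewrite row_free_unit unitmx1.
  by rewrite mul1mx mulmx1 eq_pi.
pose H := [set g in Sp W | pi' g == pi (d * g * d^-1)%g].
have gH : group_set H.
  apply/group_setP; split=> [|g1 h].
    by apply/setIdP; rewrite group1 mulg1 mulgV !repr_mx1 eqxx.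
  case/setIdP=> Sg1 /eqP Eg /setIdP[Sh /eqP Eh]; apply/setIdP; rewrite groupM //.
  by rewrite repr_mxM // Eg Eh -repr_mxM ?memJV_norm // !mulgA mulgKV.
have [o [So oe oes]] := omega_exists P.
suff HS : g \in Sp W -> g \in Group gH by move/HS/setIdP=> [_ /eqP].
apply: (Sp_gen (P := P) (o := o)) => //.
  move=> a v Xsv; apply/setIdP; rewrite transv_Sp; split=> //; apply/eqP/CX_inj => f.
  rewrite (weil_transv _ _ piW') //; case: (piW) => piN _ _.
  rewrite (piN _ (fun w => (b * a * B w v) *: v)); last first.
  - move=> y Xsy; rewrite !permM dXs // transvE linearZl_LR /= (formXsXs Xsy Xsv).
    by rewrite !mulr0 scale0r addr0 -dXs // permK.
  - move=> x Xx; rewrite rpredZ //; split=> //.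
    rewrite !permM dX // transvE.
    rewrite linear_permD ?GSp_linear ?groupV // linear_permZ ?GSp_linear ?groupV //.
    by rewrite dVX // dVXs // scalerA mulrC mulrA.
  - exact: memJV_norm Nd (transv_Sp a v).
  apply: eq_CX => y _; rewrite Epsi /char_scale linearZr_LR /=.
  by congr (psi _ * _); ring.
apply/setIdP; split=> //; apply/eqP/CX_inj => f.
have [l [Sl lX lXs]] := levi_exists P nzb.
have -> : (d * o * d^-1)%g = (l * o)%g.
  apply/permP=> w; apply: (linear_ext (P := P) (f1 := fun w => (d * o * d^-1)%g w)
     (f2 := fun w => (l * o)%g w)) => [a u v|a u v|i|i].
  - by apply/linear_permP/GSp_linear; rewrite !groupM ?groupV // (subsetP (Sp_sub_GSp W)).
  - by apply/linear_permP/Sp_linear; rewrite groupM.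
  - rewrite !permM dX ?mem_e // lX ?mem_e // linear_permZ ?Sp_linear // oe.
    by rewrite dVXs ?rpredN ?mem_es.
  rewrite !permM dXs ?mem_es // lXs ?mem_es // !(linear_permZ _ _ (Sp_linear So)).
  by rewrite oes dVX ?rpredZ ?mem_e.
case: piW piW' => _ piL piO [_ _ piO'].
rewrite repr_mxM // -mulmxA piO // piL //; last first.
- by move=> y Xsy; rewrite lXs // rpredZ.
- by move=> x Xx; rewrite lX // rpredZ.
rewrite piO' //; apply: eq_CX => y Xy.
have -> : det_X P l = b ^+ m.
  rewrite /det_X -[RHS](det_scalar m b) //; congr (\det _); apply/matrixP=> i j.
  by rewrite !mxE lX ?mem_e // linearZl_LR /= pol_ees mulr_natr.
rewrite mulrA; congr (_ * _).
  have -> : gauss_sum psi' = gauss_sum (char_scale psi b) by apply: eq_bigr.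
  rewrite gauss_sum_scale // legendreX -!exprVn -exprMn; congr (_ ^+ _).
  rewrite invfM; congr (_ * _); rewrite /legendre (negPf nzb).
  by case: ifP; rewrite ?invr1 // invrN invr1.
apply: eq_bigr => x _; congr (_ * _); rewrite Epsi /char_scale lX //.
by rewrite linear_permZ ?Sp_linear // linearZr_LR.
Qed.

(** The operator is diagonal, and <x, e_i^*> is equidistributed when x runs
through X, as translating x by t e_i adds t to it. *)
Lemma trace_weil_transv psi (pi : mx_representation C (Sp W) N) i :
  weil_formulas psi pi ->
  \tr (pi (transv 1 (es i))) =
    #|[set x in setX_pol P | B (x : W) (es i) == 0]|%:R * gauss_sum psi.
Proof.
move=> piW; pose phi (y : W) : C := psi (2^-1 * (1 * B y (es i) ^+ 2)).
have -> : pi (transv 1 (es i)) = diag_mx (CX P phi)^T.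
  apply: CX_inj => f; rewrite (weil_transv _ _ piW) ?mem_es //.
  by apply/colP=> j; rewrite mul_diag_mx !mxE.
rewrite mxtrace_diag; transitivity (\sum_(x in setX_pol P) phi x).
  by rewrite [RHS]big_enum_val; apply: eq_bigr => j _; rewrite !mxE.
rewrite (partition_big (fun x : W' => B (x : W) (es i)) predT) //= mulr_sumr.
apply: eq_bigr => t _.
rewrite (eq_bigr (fun=> psi (t ^+ 2 / 2))) => [|x /andP[_ /eqP Dt]]; last first.
  by rewrite /phi Dt mul1r mulrC.
rewrite sumr_const mulr_natl; congr (_ *+ _).
have add_inj : injective (fun x : W' => (x : W) + t *: e i : W') by apply: addIr.
rewrite -[RHS](card_imset _ add_inj); apply: eq_card => x; rewrite [LHS]inE.
apply/andP/imsetP => [[Xx /eqP Dt]|[y /setIdP[Xy /eqP By0] ->]].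
  exists ((x : W) - t *: e i); last by rewrite subrK.
  apply/setIdP; move: Xx; rewrite !inE => Xx; rewrite rpredB ?rpredZ ?mem_e //.
  by rewrite linearBl linearZl_LR /= Dt pol_ees eqxx mulr1 subrr.
move: Xy; rewrite !inE => Xy; rewrite rpredD ?rpredZ ?mem_e //.
by rewrite linearDl linearZl_LR /= By0 pol_ees eqxx mulr1 add0r.
Qed.
End WeilUniqueness.

Section WeilRestriction.
Variables (F : finFieldType) (c : coverData F) (m : nat) (W : symplSpace F m).
Variables (P : polarization W) (C : fieldType).
Hypothesis charC0 : [pchar C] =i pred0.
Local Notation N := #|setX_pol P|.
Local Notation repr := (mx_representation C (Sp W) N).
Implicit Types (psi : F -> C) (pi : repr).

Let natC_neq0 n : (n%:R == 0 :> C) = (n == 0%N).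
Proof. by move/pcharf0P: charC0. Qed.

Let two_neq0 := coverData_two_neq0 c.

Lemma weil_square_rsim psi psi' b (pi pi' : repr) :
  nontrivial_char psi -> b != 0 -> psi' =1 char_scale psi b -> is_square b ->
  weil_formulas psi pi -> weil_formulas psi' pi' -> mx_rsim pi' pi.
Proof.
move=> npsi nzb Epsi sb piW piW'.
have [d [Nd [Gd ld]]] := weil_twist two_neq0 npsi nzb Epsi piW piW'.
by move/mx_rsim_trans; apply; apply: twist_square_rsim; rewrite // ld is_squareV.
Qed.

Lemma rho_Sp_weil psi psi' b (pi pi' : repr) :
  nontrivial_char psi -> b != 0 -> psi' =1 char_scale psi b -> ~~ is_square b ->
  weil_formulas psi pi -> weil_formulas psi' pi' ->
  mx_rsim (rho_Sp c pi) (dadd_grepr (Representation pi) (Representation pi')).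
Proof.
move=> npsi nzb Epsi nsb piW piW'.
have [d [Nd [Gd ld tw]]] := weil_twist two_neq0 npsi nzb Epsi piW piW'.
have nsd : ~~ is_square (sim_factor d) by rewrite ld is_squareV.
apply: mx_rsim_trans (rho_Sp_rsim c P pi Nd Gd nsd) _.
by apply: dadd_rsim; [apply: mx_rsim_refl | apply: mx_rsim_sym].
Qed.

Lemma weil_not_rsim psi a (pi pia : repr) :
  nontrivial_char psi -> a != 0 -> ~~ is_square a ->
  weil_formulas psi pi -> weil_formulas (char_scale psi a) pia -> ~ mx_rsim pi pia.
Proof.
move=> npsi nza nsa piW piaW Epi; pose i := Ordinal (sympl_gt0 W).
have := mxtrace_rsim Epi (transv_Sp 1 (pol_es P i)).
rewrite (trace_weil_transv _ piW) (trace_weil_transv _ piaW).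
rewrite gauss_sum_scale // /legendre (negPf nza) (negPf nsa) mulN1r mulrN.
(* X contains 0, so the multiplicity K of the Gauss sum is positive. *)
set K := _%:R; have nzK : K != 0.
  rewrite natC_neq0 -lt0n; apply/card_gt0P; exists 0.
  by rewrite !inE mem0v linear0l eqxx.
have nzg : gauss_sum psi != 0.
  have : gauss_sum psi * gauss_sum (char_scale psi (-1)) != 0.
    by rewrite gauss_sumM // natC_neq0 -lt0n; apply/card_gt0P; exists 0.
  by rewrite mulf_eq0 => /norP[].
move/eqP; rewrite -addr_eq0 -mulr2n -mulr_natl !mulf_eq0 natC_neq0.
by rewrite (negPf nzK) (negPf nzg).
Qed.
End WeilRestriction.

Theorem mainTheorem1 (R : realType) (F : finFieldType)
    (hq : (#|F| = 1 %[mod 4])%N) (m : nat) (W : symplSpace F m)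
    (P : polarization W) (c : coverData F)
    (psi : F -> R[i]) (hpsi : nontrivial_char psi)
    (pi : mx_representation R[i] (Sp W) #|setX_pol P|)
    (hpi : weil_repr psi pi) :
  [/\ Sp_emb c W @* Sp W <| PGSp c W,
      (PGSp c W / (Sp_emb c W @* Sp W))
        \isog ([set: {unit F}] / [set (u ^+ 2)%g | u : {unit F}]),
      forall (a : F) (pia : mx_representation R[i] (Sp W) #|setX_pol P|),
        a != 0 -> ~~ is_square a -> weil_repr (char_scale psi a) pia ->
        [/\ mx_rsim (rho_Sp c pi)
              (dadd_grepr (Representation pi) (Representation pia)),
            ~ mx_rsim pi pia
          & forall (psi' : F -> R[i])
                   (pi' : mx_representation R[i] (Sp W) #|setX_pol P|),
              nontrivial_char psi' -> weil_repr psi' pi' ->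
              mx_rsim pi' pi \/ mx_rsim pi' pia]
    & forall (psi' : F -> R[i])
             (pi' : mx_representation R[i] (Sp W) #|setX_pol P|),
        nontrivial_char psi' -> weil_repr psi' pi' ->
        mx_rsim (rho_Sp c pi) (rho_Sp c pi')].
Proof.
have charC0 : [pchar R[i]] =i pred0 by exact: Num.Theory.pchar_num.
have nzq : #|F|%:R != 0 :> R[i].
  by move/pcharf0P: charC0 => ->; rewrite -lt0n; apply/card_gt0P; exists 0.
have [piW _] := hpi; split.
- exact: Sp_emb_normal.
- exact: PGSp_quotient_isog.
- move=> a pia nza nsa [piaW _]; split.
  + exact: (rho_Sp_weil c hpsi nza).
  + exact: (weil_not_rsim c charC0 hpsi nza nsa).
  move=> psi' pi' hpsi' [piW' _].
  have [b nzb Eb] := char_dual nzq hpsi hpsi'.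
  have [sb|nsb] := boolP (is_square b); first by left; apply: (weil_square_rsim c hpsi nzb Eb).
  (* psi' = (psi^a)^(b / a), where b / a is a square. *)
  have nzba : b / a != 0 by rewrite mulf_neq0 ?invr_eq0.
  right; apply: (weil_square_rsim c (char_scale_nontrivial nza hpsi) nzba _ _ piaW piW').
    by move=> t; rewrite Eb /char_scale mulrA mulrCA mulfV ?mulr1.
  by apply: nonsqM; [exact: negPf | rewrite is_squareV; exact: negPf].
move=> psi' pi' hpsi' [piW' _].
have [b nzb Eb] := char_dual nzq hpsi hpsi'.
have [d [Nd [Gd _ Epi']]] := weil_twist (coverData_two_neq0 c) hpsi nzb Eb piW piW'.
apply: mx_rsim_sym.
exact: mx_rsim_trans (rho_Sp_congr c P Epi') (rho_Sp_twist c P pi Nd Gd).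
Qed.
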